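(* Suppose that $f$ has the MLR property, i.e. $f(x_1-\eta_1)f(x_2-\eta_2)\ge f(x_1-\eta_2)f(x_2-\eta_1)$ whenever $x_1<x_2$ and $\eta_1<\eta_2$, and that $W$ is absolutely continuous and satisfies (C1)--(C3) (listed in the context). Let $b_0$ be the unique solution of $\int_{-\infty}^{\infty}W'(x-b_0)f(x)F(x)\,dx=0$. Let $\delta_\phi(\mathbf X)=X_{(2)}-\phi(U)$ be a location equivariant estimator of $\theta_{(2)}$ such that (i) $\phi(t)$ is increasing in $t\in[0,\infty)$; (ii) $\lim_{t\to\infty}\phi(t)=b_0$; (iii) $\int_{-\infty}^{\infty}W'(z-\phi(t))\,[F(z)-F(z-t)]\,f(z)\,dz\le 0$ for all $t\in[0,\infty)$. Then $\delta_\phi$ is an improvement over $\delta_{b_0}(\mathbf X)=X_{(2)}-b_0$ under the loss $W(a-\theta_{(2)})$, in the sense that $R(\boldsymbol\theta,\delta_\phi)\le R(\boldsymbol\theta,\delta_{b_0})$ for all $\boldsymbol\theta\in\mathbb{R}^2$.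
   Context: Setting: $f$ is a Lebesgue probability density on $\mathbb{R}$ with distribution function $F(x)=\int_{-\infty}^x f(t)\,dt$; $X_1,X_2$ are independent and $X_i$ has density $x\mapsto f(x-\theta_i)$, where $\boldsymbol\theta=(\theta_1,\theta_2)\in\mathbb{R}^2$ is unknown. Write $\theta_{(2)}=\max\{\theta_1,\theta_2\}$, $X_{(1)}=\min\{X_1,X_2\}$, $X_{(2)}=\max\{X_1,X_2\}$, $U=X_{(2)}-X_{(1)}$, $\mathbf X=(X_1,X_2)$, $\phi:[0,\infty)\to\mathbb{R}$. The loss for estimating $\theta_{(2)}$ is $L(\boldsymbol\theta,a)=W(a-\theta_{(2)})$, $W:\mathbb{R}\to[0,\infty)$; the risk of $\delta$ is $R(\boldsymbol\theta,\delta)=E_{\boldsymbol\theta}[W(\delta(\mathbf X)-\theta_{(2)})]$. Conditions on $W$: (C1) $W(0)=0$, $W$ is strictly decreasing on $(-\infty,0)$ and strictly increasing on $(0,\infty)$; (C2) $W'$ is increasing almost everywhere; (C3) the integrals involving $W$ are finite and differentiation under the integral sign is permissible. *)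

(* Defs.v *)
From HB Require Import structures.
From mathcomp Require Export all_boot all_order all_algebra.
From mathcomp Require Export all_classical all_reals all_analysis.
Export Order.TTheory GRing.Theory Num.Theory.
Export numFieldNormedType.Exports.

Set Implicit Arguments.
Unset Strict Implicit.
Unset Printing Implicit Defensive.

Local Open Scope ring_scope.
Local Open Scope classical_set_scope.

Section densities.
Context {R : realType}.
Local Notation mu := (@lebesgue_measure R).
Implicit Types f W : R -> R.

Definition prob_density f : Prop :=
  [/\ measurable_fun setT f, (forall x, 0 <= f x)
    & (\int[mu]_x (f x)%:E = 1)%E].

Definition dist_fun f (x : R) : R := \int[mu]_(t in `]-oo, x]) f t.

Definition MLR f : Prop := forall x1 x2 eta1 eta2 : R,
  x1 < x2 -> eta1 < eta2 ->
  f (x1 - eta2) * f (x2 - eta1) <= f (x1 - eta1) * f (x2 - eta2).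

Definition abs_continuous_on (a b : R) W : Prop :=
  forall e, 0 < e -> exists2 d, 0 < d &
    forall (n : nat) (l r : 'I_n -> R),
      (forall i, [/\ a <= l i, l i <= r i & r i <= b]) ->
      (forall i j, i != j -> r i <= l j \/ r j <= l i) ->
      \sum_(i < n) (r i - l i) < d ->
      \sum_(i < n) `|W (r i) - W (l i)| < e.

(* On the unbounded line, absolute continuity is understood on every compact
   interval; globally it would already exclude the squared error loss. *)
Definition abs_continuous W : Prop := forall a b, a < b -> abs_continuous_on a b W.

Definition condC1 W : Prop :=
  [/\ W 0 = 0,
      (forall x y, x < y -> y < 0 -> W y < W x)
    & (forall x y, 0 < x -> x < y -> W x < W y)].

(* "Increasing" is in the wide sense, so that absolute error loss qualifies.
   Asking for derivability off the null set costs nothing, since [W] is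
   absolutely continuous; it makes [derive1 W] there the actual derivative rather
   than the default value of the limit. *)
Definition condC2 W : Prop := exists2 N : set R, mu.-negligible N &
  (forall x, ~ N x -> derivable W x 1) /\
  (forall x y, ~ N x -> ~ N y -> x <= y -> derive1 W x <= derive1 W y).

(* c |-> \int W (z - c) k(z) dz is finite and may be differentiated under the
   integral sign, at every c. *)
Definition diff_under_integral W (k : R -> R) : Prop := forall c : R,
  [/\ mu.-integrable setT (fun z => (W (z - c) * k z)%:E),
      mu.-integrable setT (fun z => (derive1 W (z - c) * k z)%:E)
    & is_derive c 1 (fun b : R => \int[mu]_z (W (z - b) * k z))
        (- \int[mu]_z (derive1 W (z - c) * k z))].

End densities.

Section model.
Context {R : realType} {d : measure_display} {T : measurableType d}.
Local Notation mu := (@lebesgue_measure R).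

Definition has_density (Q : probability T R) (X : T -> R) (g : R -> R) : Prop :=
  forall A : set R, measurable A ->
    (Q (X @^-1` A) = \int[mu]_(x in A) (g x)%:E)%E.

Definition independent2 (Q : probability T R) (X Y : T -> R) : Prop :=
  forall A B : set R, measurable A -> measurable B ->
    (Q (X @^-1` A `&` Y @^-1` B) = Q (X @^-1` A) * Q (Y @^-1` B))%E.

(* [P theta] is the law on the sample space when the parameter is [theta]. *)
Definition location_model (f : R -> R) (P : R * R -> probability T R)
    (X1 X2 : {mfun T >-> R}) : Prop :=
  forall theta : R * R,
    [/\ has_density (P theta) X1 (fun x => f (x - theta.1)),
        has_density (P theta) X2 (fun x => f (x - theta.2))
      & independent2 (P theta) X1 X2].

(* X_(2) - phi(U), with U = X_(2) - X_(1); since U >= 0, only the restriction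
   of [phi] to [0, +oo[ matters. *)
Definition equivariant_est (phi : R -> R) (x1 x2 : R) : R :=
  Num.max x1 x2 - phi (Num.max x1 x2 - Num.min x1 x2).

Definition risk (P : R * R -> probability T R) (X1 X2 : {mfun T >-> R})
    (W : R -> R) (theta : R * R) (delta : R -> R -> R) : \bar R :=
  'E_(P theta)[fun w => W (delta (X1 w) (X2 w) - Num.max theta.1 theta.2)].

(* The integrals involving [W] are taken to be the risks of the estimators
   X_(2) - c and, for the weights k = f F and k = (F - F(. - t)) f, the
   integrals of W(z - c) k(z) together with their derivatives in c. Finiteness
   of the risk of X_(2) - phi(U) for bounded monotone [phi] then follows. *)
Definition condC3 (f : R -> R) (P : R * R -> probability T R)
    (X1 X2 : {mfun T >-> R}) (W : R -> R) : Prop :=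
  let F := dist_fun f in
  [/\ (forall theta c,
         (risk P X1 X2 W theta (equivariant_est (cst c)) < +oo)%E),
      diff_under_integral W (fun z => f z * F z)
    & (forall t, 0 <= t ->
         diff_under_integral W (fun z => (F z - F (z - t)) * f z))].

End model.

(* Main.v *)
(** Let [theta_1 <= theta_2] and [lam = theta_2 - theta_1].  On the event [U <= t]
    the variable X_(2) - theta_(2) has the density
      [s_lam(z) = f(z) w(z + lam) + f(z + lam) w(z)],  [w(z) = F(z) - F(z - t)].
    The MLR property makes [s_lam / (f w)] nonincreasing.  [W] is convex, so for
    [c <= c'] the increment [D(z) = W(z - c') - W(z - c)] is nonincreasing too and
    changes sign once; hence [\int D f w >= 0] implies [\int D s_lam >= 0], that is,
    on [U <= t] the shift [c] is at least as good as [c'].  For [phi(t) <= c] the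
    premise is a consequence of (iii), since [D(z) >= -(c' - c) W'(z - phi(t))].
    Rounding [phi] up to a finite grid of values ending at [b0], and raising these
    values to [b0] one at a time, only ever replaces [c] by [c'] on an event
    [phi(U) <= c], which is an increasing union of events [U <= t]; so the rounded
    estimator beats X_(2) - b0.  Refining the grid and applying Fatou's lemma gives
    the result.  The rounding stands in for a derivative of [phi], which may jump. *)
From HB Require Import structures.
Require Import Defs.
From mathcomp Require Import measurable_realfun ring lra.

Set Implicit Arguments.
Unset Strict Implicit.
Unset Printing Implicit Defensive.

Local Open Scope ring_scope.
Local Open Scope classical_set_scope.

(** * Monotonicity of absolutely continuous functions from the sign of the derivative *)

Lemma derivable_approx (R : realType) (g : R -> R) (s e : R) :
  derivable g s 1 -> 0 < e ->
  exists2 eta : R, 0 < eta & forall y, `|y - s| < eta ->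
    `|g y - g s - derive1 g s * (y - s)| <= e * `|y - s|.
Proof.
move=> dg e0.
have : h^-1 *: (g (h *: 1 + s) - g s) @[h --> 0^'] --> derive1 g s.
  rewrite derive1E; exact: dg.
move=> /cvgrPdist_le/(_ e e0).
rewrite near_withinE => -[eta /= eta0 H]; exists eta => // y ys.
have [->|yNs] := eqVneq y s; first by rewrite !subrr mulr0 subrr !normr0 mulr0.
have h0 : y - s != 0 by rewrite subr_eq0.
have := H (y - s); rewrite /ball_ /= sub0r normrN => /(_ ys h0).
rewrite [_ *: 1]mulr1 subrK.
have -> : g y - g s - derive1 g s * (y - s) =
  - ((derive1 g s - (y - s)^-1 *: (g y - g s)) * (y - s)).
  by rewrite /GRing.scale /=; field.
by rewrite normrN normrM; apply: ler_wpM2r.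
Qed.

Section abs_cont_mono.
Variables (R : realType).
Local Notation mu := (@lebesgue_measure R).

Lemma open_seg (U : set R) (s : R) : open U -> U s ->
  exists2 eta : R, 0 < eta & forall y, `|y - s| < eta -> U y.
Proof.
move=> oU Us; have : nbhs s U by exact: open_nbhs_nbhs.
move=> /nbhs_ballP[eta /= eta0 H]; exists eta => // y ys; apply: H.
by rewrite /ball /= distrC.
Qed.

(* From [a] to [x], [g] has dropped by at most [e * (x - a)] plus its variation
   over finitely many intervals inside [U]. *)
Definition reach (g : R -> R) (U : set R) (a e x : R) : Prop :=
  exists n, exists l r : 'I_n -> R,
  [/\ forall i, [/\ a <= l i, l i <= r i & r i <= x],
      forall i j, i != j -> r i <= l j \/ r j <= l i,
      ((\sum_(i < n) (r i - l i))%:E <= mu (U `&` `]a, x]))%E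
    & g a - e * (x - a) - \sum_(i < n) `|g (r i) - g (l i)| <= g x].

Lemma reach0 g U a e : reach g U a e a.
Proof.
exists 0%N, (fun=> 0), (fun=> 0); split; [by case|by case| |].
  by rewrite big_ord0 measure_ge0.
by rewrite big_ord0 subrr mulr0 !subr0.
Qed.

(** No interval is added to the family: the drop over the new piece is paid for by the growth of
    [e * (x - a)]. *)
Lemma reach_slope g (U : set R) a e x y : open U -> a <= x -> x <= y ->
  - (e * (y - x)) <= g y - g x -> reach g U a e x -> reach g U a e y.
Proof.
move=> oU ax xy gxy [n [l [r [lr dis len gx]]]]; exists n, l, r; split => //.
- by move=> i; have [? ? rx] := lr i; split => //; exact: le_trans xy.
- apply: (le_trans len); apply: le_measure; rewrite ?inE.
  + by apply: measurableI => //; exact: open_measurable.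
  + by apply: measurableI => //; exact: open_measurable.
  + apply: setIS => z /=; rewrite !in_itv /= => /andP[-> zx].
    exact: le_trans xy.
- move: gx gxy; set s := \sum_(i < n) _; nra.
Qed.

(** The new piece joins the family as one more interval. Its variation pays for the drop, and its
    length is available in the measure of [U], because the piece lies inside [U]. *)
Lemma reach_inside g (U : set R) a e x y : open U -> 0 <= e -> a <= x -> x <= y ->
  `[x, y] `<=` U -> reach g U a e x -> reach g U a e y.
Proof.
move=> oU e0 ax xy xyU [n [l [r [lr dis len gx]]]].
pose ext (k : 'I_n -> R) z (i : 'I_n.+1) := if unlift ord_max i is Some j then k j else z.
have extw k z (i : 'I_n) : ext k z (widen_ord (leqnSn n) i) = k i.
  rewrite /ext; have -> : widen_ord (leqnSn n) i = lift ord_max i.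
    by apply: val_inj; rewrite /= /bump leqNgt ltn_ord.
  by rewrite liftK.
have extm k z : ext k z ord_max = z by rewrite /ext unlift_none.
exists n.+1, (ext l x), (ext r y); split.
- move=> i; rewrite /ext; case: unliftP => [j|] _; last by split.
  by have [? ? rx] := lr j; split => //; exact: le_trans xy.
- move=> i j; rewrite /ext; case: unliftP => [i'|] ->; case: unliftP => [j'|] ->.
  + by rewrite (inj_eq lift_inj); exact: dis.
  + by move=> _; left; have [] := lr i'.
  + by move=> _; right; have [] := lr j'.
  + by rewrite eqxx.
- rewrite big_ord_recr /= !extm; under eq_bigr do rewrite !extw.
  rewrite EFinD (_ : (y - x)%:E = mu `]x, y]%classic); last first.
    by rewrite lebesgue_measure_itv /= lte_fin; case: ltgtP xy => // -> _; rewrite subrr.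
  have -> : U `&` `]a, y] = (U `&` `]a, x]) `|` `]x, y].
    apply/seteqP; split => z /=; rewrite !in_itv /=.
      by move=> [Uz /andP[az zy]]; case: (leP z x) => zx; [left; split => //; rewrite az|right].
    case=> [[Uz /andP[-> zx]]|/andP[xz zy]]; first by rewrite (le_trans zx).
    split; first by apply: xyU; rewrite /= in_itv /= ltW.
    by rewrite (le_lt_trans ax xz).
  have mU := open_measurable oU.
  rewrite measureU //; first by rewrite leeD2r.
    exact: measurableI.
  apply/seteqP; split => // z /= [[_]]; rewrite !in_itv /= => /andP[_ zx] /andP[xz _].
  by move: (lt_le_trans xz zx); rewrite ltxx.
- rewrite big_ord_recr /= !extm; under eq_bigr do rewrite !extw.
  have := ler_norm (g x - g y); rewrite distrC.
  move: gx; set s := \sum_(i < n) _; nra.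
Qed.

(* [U] is an open neighbourhood of the exceptional set [N], so small that by
   absolute continuity [g] varies by less than [e] over intervals inside [U].
   Every point, in [U] or not, is jumped over by some step that preserves
   [reach], so the supremum of the reachable points is [b]. *)
Lemma abs_cont_nondecreasing (a b : R) (g : R -> R) (N : set R) :
  a <= b -> abs_continuous_on a b g -> mu.-negligible N ->
  (forall x, a <= x -> x <= b -> ~ N x -> derivable g x 1 /\ 0 <= derive1 g x) ->
  g a <= g b.
Proof.
move=> ab ac N0 dg.
(* The slope steps may lose [e * (b - a)] in total, the steps inside [U] another [e]. *)
suff H e : 0 < e -> g a - e * (b - a) - e <= g b.
  apply/ler_addgt0Pr => e e0.
  have ba1 : 0 < b - a + 1 by lra.
  have := H (e / (b - a + 1)) (divr_gt0 e0 ba1).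
  suff : e = e / (b - a + 1) * (b - a) + e / (b - a + 1).
    set z := e / _; lra.
  by field; rewrite gt_eqF.
move=> e0; have [d d0 acd] := ac e e0.
(* Half of [d], since the bound on the measure of [U] is weak while absolute continuity asks for a
   strict one. *)
have [U [oU NU muU]] := outer_measure_open_le N (divr_gt0 d0 (@ltr0n R 2)).
rewrite (negligible_outer_measure N).1 // add0e in muU.
(* Steps straddle [s]: outside [U] the first-order expansion compares values with [g s] only, so
   [g y - g x] is split at [s] and each half loses at most [e] times its length. *)
have local s : a <= s -> s <= b -> exists2 eta : R, 0 < eta & forall x y,
    a <= x -> s - eta < x -> x <= s -> s <= y -> y <= b -> y < s + eta ->
    reach g U a e x -> reach g U a e y.
  move=> as_ sb; have [Us|Us] := pselect (U s).
    have [eta eta0 H] := open_seg oU Us; exists eta => // x y ax sx xs sy yb ys.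
    apply: (reach_inside oU (ltW e0) ax (le_trans xs sy)) => z /=.
    rewrite in_itv /= => /andP[xz zy]; apply: H; rewrite ltr_norml; lra.
  have [ds ds0] := dg s as_ sb (fun Ns => Us (NU _ Ns)).
  have [eta eta0 H] := derivable_approx ds e0; exists eta => // x y ax sx xs sy yb ys.
  apply: (reach_slope oU ax (le_trans xs sy)).
  have := H x; rewrite ltr_norml ler_norml (ler0_norm (_ : x - s <= 0)) ?subr_le0//.
  move=> /(_ ltac:(lra))/andP[_ hx].
  have := H y; rewrite ltr_norml ler_norml (ger0_norm (_ : 0 <= y - s)) ?subr_ge0//.
  move=> /(_ ltac:(lra))/andP[hy _]; nra.
pose S := [set x | [/\ a <= x, x <= b & reach g U a e x]].
have Sa : S a by split => //; exact: reach0.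
have hS : has_sup S by split; [exists a|exists b => x []].
have as_ : a <= sup S by apply: ub_le_sup => //; case: hS.
have sb : sup S <= b by apply: ge_sup; [exists a|move=> x []].
have [eta eta0 H] := local _ as_ sb.
have [x [ax xb rx] sx] := sup_adherent eta0 hS.
have xs : x <= sup S by apply: ub_le_sup; [case: hS|split].
have step y : sup S <= y -> y <= b -> y < sup S + eta -> reach g U a e y.
  by move=> sy yb yS; exact: (H x).
have Rb : reach g U a e b.
  apply: (step _) => //; rewrite ltNge; apply/negP => seb.
  have Sy : S (sup S + eta / 2) by split; [lra|lra|apply: (step _); lra].
  have : sup S + eta / 2 <= sup S by apply: ub_le_sup => //; case: hS.
  lra.
have [n [l [r [lr dis len gb]]]] := Rb.
have : \sum_(i < n) `|g (r i) - g (l i)| < e.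
  apply: acd => //; rewrite -lte_fin; apply: (le_lt_trans len).
  apply: (@le_lt_trans _ _ (mu U)).
    apply: le_measure; rewrite ?inE; [apply: measurableI => //|..|exact: subIsetl];
    exact: open_measurable.
  apply: (le_lt_trans muU); rewrite lte_fin; lra.
by move: gb; set s := \sum_(i < n) _; lra.
Qed.

End abs_cont_mono.

(** * Translation invariance of Lebesgue measure and of its integral *)

Section translation.
Variable R : realType.
Local Notation mu := (@lebesgue_measure R).

Lemma measurable_addr (c : R) : measurable_fun setT (fun x : R => x + c).
Proof. exact: measurable_funD. Qed.

(** The image of Lebesgue measure under a translation gives half-open intervals their length, and
    this determines Lebesgue measure. *)
Lemma lebesgue_measure_shift (c : R) (A : set R) : measurable A ->
  mu ((fun x => x + c) @^-1` A) = mu A.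
Proof.
move=> mA; pose sh : measurableTypeR R -> measurableTypeR R := fun x => x + c.
have msh : measurable_fun setT sh by exact: measurable_addr.
pose msh' := isMeasurableFun.Build _ _ _ _ sh msh.
pose shm : {mfun measurableTypeR R >-> measurableTypeR R} := HB.pack sh msh'.
suff -> : mu A = pushforward mu shm A by [].
apply: lebesgue_measure_unique => //= _ [[a b]] _ <-.
rewrite /pushforward /=.
have -> : shm @^-1` `]a, b] = `]a - c, b - c]%classic.
  by apply/seteqP; split => x /=; rewrite !in_itv /= /sh ltrBlDr lerBrDr.
rewrite !lebesgue_measure_itv /= !lte_fin ltrD2r.
by case: ifP => // _; rewrite -!EFinB; congr EFin; ring.
Qed.

Lemma ge0_integral_shift (c : R) (D : set R) (f : R -> \bar R) : measurable D ->
  measurable_fun D f -> (forall x, D x -> 0 <= f x)%E ->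
  (\int[mu]_(x in (fun x => x + c)%R @^-1` D) f (x + c)%R = \int[mu]_(x in D) f x)%E.
Proof.
move=> mD mf f0.
have f0' : {in D, forall y, 0 <= f y}%E by move=> x; rewrite inE; exact: f0.
have := @ge0_integral_pushforward _ _ (measurableTypeR R) (measurableTypeR R) R
  _ (measurable_addr c) mu D f mD mf f0'; rewrite /comp => <-.
by apply: eq_measure_integral => [|? A mA _]; [exact: measurable_addr|exact: (lebesgue_measure_shift c mA)].
Qed.

Lemma negligible_shift (c : R) (N : set R) : mu.-negligible N ->
  mu.-negligible ((fun x => x + c) @^-1` N).
Proof.
move=> [A [mA A0 NA]]; exists ((fun x => x + c) @^-1` A); split.
- by rewrite -[X in measurable X]setTI; exact: measurable_addr.
- by rewrite -[RHS]A0 lebesgue_measure_shift.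
- by move=> x /= /NA.
Qed.

End translation.

(** * Absolute continuity and convexity of the loss *)

Section abs_cont_theory.
Variable R : realType.
Local Notation mu := (@lebesgue_measure R).
Implicit Types f g W : R -> R.

Lemma abs_continuous_onB a b f g :
  abs_continuous_on a b f -> abs_continuous_on a b g ->
  abs_continuous_on a b (fun x => f x - g x).
Proof.
move=> cf cg e e0; have e2 : 0 < e / 2 by rewrite divr_gt0.
have [d1 d10 H1] := cf _ e2; have [d2 d20 H2] := cg _ e2.
exists (Num.min d1 d2); first by rewrite lt_min d10.
move=> n l r lr dis; rewrite lt_min => /andP[s1 s2].
rewrite [e]splitr (le_lt_trans _ (ltrD (H1 n l r lr dis s1) (H2 n l r lr dis s2))) //.
rewrite -big_split /=; apply: ler_sum => i _.
rewrite (_ : _ - _ = (f (r i) - f (l i)) - (g (r i) - g (l i))); last by ring.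
exact: ler_normB.
Qed.

Lemma abs_continuous_on_lipschitz a b k g : 0 <= k ->
  (forall x y, x <= y -> `|g y - g x| <= k * (y - x)) -> abs_continuous_on a b g.
Proof.
move=> k0 lip e e0; have k1 : 0 < k + 1 by rewrite ltr_wpDl.
(* [k + 1] instead of [k] keeps the divisor positive. *)
exists (e / (k + 1)); first by rewrite divr_gt0.
move=> n l r lr _ s.
apply: (@le_lt_trans _ _ ((k + 1) * \sum_(i < n) (r i - l i))).
  rewrite mulr_sumr; apply: ler_sum => i _; have [_ lri _] := lr i.
  apply: (le_trans (lip _ _ lri)); apply: ler_wpM2r; lra.
by rewrite mulrC -ltr_pdivlMr.
Qed.

Lemma abs_continuous_shift c W : abs_continuous W ->
  abs_continuous (fun x => W (x - c)).
Proof.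
move=> ac a b ab e e0; have [|d d0 H] := ac (a - c) (b - c) _ e e0.
  by rewrite ltrD2r.
exists d => // n l r lr dis s.
apply: (H n (fun i => l i - c) (fun i => r i - c)).
- by move=> i; have [? ? ?] := lr i; rewrite !lerD2r.
- by move=> i j /dis; rewrite !lerD2r.
- by under eq_bigr do rewrite opprB addrA subrK.
Qed.

Lemma abs_continuous_continuous W : abs_continuous W -> continuous W.
Proof.
move=> ac x; apply/cvgrPdist_lt => e e0.
have [|d d0 H] := ac (x - 1) (x + 1) _ e e0; first by lra.
have m0 : 0 < Num.min d 1 by rewrite lt_min d0 ltr01.
apply/nbhs_ballP; exists (Num.min d 1) => //= y.
rewrite /ball /= lt_min => /andP[xyd xy1].
have seg u v : u <= v -> x - 1 <= u -> v <= x + 1 -> v - u < d -> `|W v - W u| < e.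
  move=> uv xu vx vud.
  have := H 1%N (fun=> u) (fun=> v); rewrite !big_ord1; apply => //.
  by move=> i j; rewrite !ord1.
move: xy1; rewrite ltr_norml => /andP[xy1 xy2].
have [xy|/ltW yx] := leP x y.
  by rewrite distrC; apply: seg; rewrite ?ler0_norm ?subr_le0// opprB in xyd *; lra.
by apply: seg; rewrite ?ger0_norm ?subr_ge0// in xyd *; lra.
Qed.

Lemma derivable_shift W c x : derivable W (x - c) 1 ->
  derivable (fun z => W (z - c)) x 1 /\
  derive1 (fun z => W (z - c)) x = derive1 W (x - c).
Proof.
move=> dW; have H : is_derive x 1 (fun z => W (z - c)) (derive1 W (x - c)).
  have dW' : is_derive (x - c) 1 W (derive1 W (x - c)).
    by rewrite derive1E; exact: DeriveDef.
  have ds : is_derive x 1 (fun z : R => z - c) 1.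
    by rewrite -[X in is_derive _ _ _ X]subr0; exact: is_deriveB.
  have := is_derive1_comp (f := W) (g := fun z => z - c) (x := x).
  by rewrite -[X in _ -> is_derive _ _ _ X](mulr1 (derive1 W (x - c))); apply.
by split; [exact: ex_derive|rewrite derive1E; exact: derive_val].
Qed.

Lemma derivableB f g x : derivable f x 1 -> derivable g x 1 ->
  derivable (fun z => f z - g z) x 1 /\
  derive1 (fun z => f z - g z) x = derive1 f x - derive1 g x.
Proof.
move=> df dg; split; first exact: derivableB.
by rewrite !derive1E; exact: deriveB.
Qed.

(** Convexity of [W], in terms of increments. Off two translates of [N], the negated increment has
    derivative [W'(z - c) - W'(z - c')], which is nonnegative because [z - c' <= z - c]. *)
Lemma increments_nonincreasing W : abs_continuous W -> condC2 W ->
  forall c c' x y, c <= c' -> x <= y ->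
  W (y - c') - W (y - c) <= W (x - c') - W (x - c).
Proof.
move=> ac [N N0 [dW mW]] c c' x y cc'; rewrite le_eqVlt => /predU1P[->//|xy].
pose g z := W (z - c) - W (z - c').
suff : g x <= g y by rewrite /g; lra.
apply: (@abs_cont_nondecreasing _ _ _ g
  ((fun z => z - c) @^-1` N `|` (fun z => z - c') @^-1` N)); first exact: ltW.
- by apply: abs_continuous_onB; exact: abs_continuous_shift.
- by apply: negligibleU; exact: negligible_shift.
- move=> z _ _ /not_orP[/= Nc Nc'].
  have [d1 e1] := derivable_shift (dW _ Nc).
  have [d2 e2] := derivable_shift (dW _ Nc').
  have [dg eg] := derivableB d1 d2; split => //.
  by rewrite eg e1 e2 subr_ge0; apply: mW => //; rewrite lerD2l lerN2.
Qed.

(** The supporting line of a convex function. Subtracting from [W] the line of slope [W'(x)] leaves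
    a function that is nondecreasing to the right of [x] and nonincreasing to its left, so [x]
    minimises it. *)
Lemma tangent_below W (N : set R) : abs_continuous W -> mu.-negligible N ->
  (forall x, ~ N x -> derivable W x 1) ->
  (forall x y, ~ N x -> ~ N y -> x <= y -> derive1 W x <= derive1 W y) ->
  forall x y, ~ N x -> W x + derive1 W x * (y - x) <= W y.
Proof.
move=> ac N0 dW mW x y Nx; set k := derive1 W x.
have lin : forall a b, abs_continuous_on a b (fun z : R => k * z).
  move=> a b; apply: (@abs_continuous_on_lipschitz _ _ `|k|) => // u v uv.
  by rewrite -mulrBr normrM (ger0_norm (_ : 0 <= v - u)) ?subr_ge0.
have dlin z : derivable (fun z : R => k * z) z 1 /\ derive1 (fun z : R => k * z) z = k.
  have H : is_derive z 1 (fun z : R => k * z) k.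
    by rewrite -[X in is_derive _ _ _ X]mulr1; exact: is_deriveZ.
  by split; [exact: ex_derive|rewrite derive1E; exact: derive_val].
have [->|yx] := eqVneq y x; first by rewrite subrr mulr0 addr0.
have [xy|yx'] := leP x y.
  have xy' : x < y by rewrite lt_neqAle eq_sym yx.
  have : W x - k * x <= W y - k * y; last by lra.
  apply: (@abs_cont_nondecreasing _ _ _ (fun z => W z - k * z) N) => //.
    by apply: abs_continuous_onB => //; exact: ac.
  move=> z xz _ Nz; have [dk ek] := dlin z.
  have [dg eg] := derivableB (dW _ Nz) dk; split => //.
  by rewrite eg ek subr_ge0; exact: mW.
have : k * y - W y <= k * x - W x; last by lra.
apply: (@abs_cont_nondecreasing _ _ _ (fun z => k * z - W z) N) => //; first exact: ltW.
  by apply: abs_continuous_onB => //; exact: ac.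
move=> z _ zx Nz; have [dk ek] := dlin z.
have [dg eg] := derivableB dk (dW _ Nz); split => //.
by rewrite eg ek subr_ge0; exact: mW.
Qed.

End abs_cont_theory.

(** * Distribution function, windows and slices of a density *)

Section densities.
Variable R : realType.
Local Notation mu := (@lebesgue_measure R).
Variable f : R -> R.
Hypothesis pf : prob_density f.

Let F := dist_fun f.

Lemma density_measurable : measurable_fun setT f. Proof. by case: pf. Qed.

Lemma density_ge0 x : 0 <= f x. Proof. by case: pf. Qed.

Lemma density_shift_measurable c : measurable_fun setT (fun x : R => f (x - c)).
Proof.
apply: (measurableT_comp density_measurable).
exact: measurable_addr.
Qed.

Lemma density_shift_measurableD c : measurable_fun setT (fun x : R => f (x + c)).
Proof. by have := density_shift_measurable (- c); rewrite opprK. Qed.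

Lemma density_integrable (D : set R) : measurable D -> mu.-integrable D (EFin \o f).
Proof.
move=> mD; apply: (integrableS measurableT) => //; apply/integrableP; split.
  by apply/measurable_EFinP; exact: density_measurable.
have [_ f0 f1] := pf.
under eq_integral do rewrite /= ger0_norm //.
by rewrite f1 ltry.
Qed.

Lemma dist_funE x : (\int[mu]_(t in `]-oo, x]) (f t)%:E = (F x)%:E)%E.
Proof.
rewrite /F /dist_fun /Rintegral fineK //.
by apply: integrable_fin_num => //; exact: density_integrable.
Qed.

Lemma dist_fun_itv a b : a <= b ->
  (\int[mu]_(t in `]a, b]) (f t)%:E = (F b - F a)%:E)%E.
Proof.
move=> ab; have fm D : measurable_fun D (EFin \o f).
  apply: measurable_funTS; apply/measurable_EFinP; exact: density_measurable.
have : (\int[mu]_(t in `]-oo, b]) (f t)%:E =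
    \int[mu]_(t in `]-oo, a]) (f t)%:E + \int[mu]_(t in `]a, b]) (f t)%:E)%E.
  rewrite -ge0_integral_setU //=.
  - congr (integral _ _ _); apply/seteqP; split => x /=; rewrite !in_itv /=.
      by move=> xb; case: (leP x a) => xa; [left|right].
    by case=> [xa|/andP[]//]; exact: le_trans ab.
  - exact: fm.
  - by move=> x _; rewrite lee_fin density_ge0.
  - rewrite disj_set2E; apply/eqP/seteqP; split => // x /=.
    by rewrite !in_itv /= => -[xa /andP[]]; rewrite ltNge xa.
rewrite !dist_funE => E.
have : (\int[mu]_(t in `]a, b]) (f t)%:E)%E \is a fin_num.
  by apply: integrable_fin_num => //; exact: density_integrable.
move: E; case: (\int[mu]_(t in _) _)%E => // r E _; move: E.
by rewrite -EFinD => -[->]; congr EFin; ring.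
Qed.

Lemma dist_fun_itv_closed a b : a <= b ->
  (\int[mu]_(t in `[a, b]) (f t)%:E = (F b - F a)%:E)%E.
Proof.
move=> ab; rewrite -dist_fun_itv // -integral_itv_obnd_cbnd //.
by apply: measurable_funTS; apply/measurable_EFinP; exact: density_measurable.
Qed.

Lemma dist_fun_itv_open a b : a <= b ->
  (\int[mu]_(t in `[a, b[) (f t)%:E = (F b - F a)%:E)%E.
Proof.
move=> ab; rewrite -dist_fun_itv_closed // integral_itv_bndo_bndc //.
by apply: measurable_funTS; apply/measurable_EFinP; exact: density_measurable.
Qed.

Lemma dist_fun_nondecreasing a b : a <= b -> F a <= F b.
Proof.
move=> ab; rewrite -subr_ge0 -lee_fin -dist_fun_itv //.
by apply: integral_ge0 => x _; rewrite lee_fin density_ge0.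
Qed.

Lemma dist_fun_measurable : measurable_fun setT F.
Proof.
apply: nondecreasing_measurable => // a b; exact: dist_fun_nondecreasing.
Qed.

(** For [t >= 0], the probability of []z - t, z]] under [f]: the chance that the smaller observation
    falls within [t] of a maximum located at [z]. *)
Definition window (t z : R) : R := F z - F (z - t).

Lemma window_ge0 t z : 0 <= t -> 0 <= window t z.
Proof. by move=> t0; rewrite subr_ge0 dist_fun_nondecreasing // gerBl. Qed.

Lemma window_measurable t c : measurable_fun setT (fun z : R => window t (z + c)).
Proof.
apply: measurable_funB; first by apply: (measurableT_comp dist_fun_measurable); exact: measurable_addr.
apply: (measurableT_comp dist_fun_measurable).
under eq_fun do rewrite -addrA; exact: measurable_addr.
Qed.

(* Density at [z] of X_(2) - theta_(2) on the event [U <= t], when the two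
   parameters differ by [lam]. *)
Definition slice (lam t z : R) : R := f z * window t (z + lam) + f (z + lam) * window t z.

Lemma slice_ge0 lam t z : 0 <= t -> 0 <= slice lam t z.
Proof. by move=> t0; rewrite addr_ge0 // mulr_ge0 ?density_ge0 ?window_ge0. Qed.

Lemma slice_measurable lam t : measurable_fun setT (slice lam t).
Proof.
apply: measurable_funD; apply: measurable_funM.
- exact: density_measurable.
- exact: window_measurable.
- exact: density_shift_measurableD.
- by have := window_measurable t 0; under eq_fun do rewrite addr0.
Qed.

End densities.

(** * Integrals against the joint law of two independent variables *)

Section pair_law.
Variables (R : realType) (d : measure_display) (T : measurableType d).
Local Notation mu := (@lebesgue_measure R).
Variable Q : probability T R.

(** [has_density] speaks of events only. It makes the law of [Y] absolutely continuous with a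
    Radon-Nikodym derivative equal to [q] almost everywhere, and the change of variables formula
    then gives the integral of [g]. *)
Lemma expectation_density (Y : {mfun T >-> R}) (q : R -> R) (g : R -> \bar R) :
  measurable_fun setT q -> has_density Q Y q ->
  measurable_fun setT g -> (forall y, 0 <= g y)%E ->
  (\int[Q]_w g (Y w) = \int[mu]_y (g y * (q y)%:E))%E.
Proof.
move=> mq dY mg g0.
have mY : measurable_fun setT (Y : T -> measurableTypeR R).
  by move=> _ A mA; exact: (@measurable_funPT _ _ _ _ Y measurableT A mA).
pose mY' := isMeasurableFun.Build _ _ T (measurableTypeR R) Y mY.
pose Y' : {mfun T >-> measurableTypeR R} := HB.pack (Y : T -> measurableTypeR R) mY'.
have dom : distribution Q Y' `<< mu.
  apply/null_content_dominatesP => A mA A0.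
  rewrite /distribution /pushforward dY //.
  by apply: null_set_integral => //; apply: measurable_funTS; apply/measurable_EFinP.
have := Radon_Nikodym_SigmaFinite.change_of_variables dom g0 measurableT mg.
rewrite (@ge0_integral_distribution _ _ _ _ _ _ Y') // => <-.
apply/esym/ae_eq_integral => //.
- by apply: emeasurable_funM => //; exact/measurable_EFinP.
- apply: emeasurable_funM => //.
  exact: measurable_int (Radon_Nikodym_SigmaFinite.f_integrable dom).
apply: ae_eqe_mul2l; apply/ae_eq_sym; apply: integral_ae_eq => //.
- exact: Radon_Nikodym_SigmaFinite.f_integrable.
- exact/measurable_EFinP.
- move=> A _ mA; rewrite -Radon_Nikodym_SigmaFinite.f_integral //.
  exact: dY.
Qed.

(** By independence the joint law is the product of the marginals. Tonelli's theorem then integrates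
    [X] out first, with [Y = y] held fixed. *)
Lemma expectation_difference_event (X Y : {mfun T >-> R}) (p q g : R -> R) (C : set R) :
  measurable_fun setT p -> (forall x, 0 <= p x) -> measurable_fun setT q ->
  has_density Q X p -> has_density Q Y q -> independent2 Q X Y ->
  measurable_fun setT g -> (forall y, 0 <= g y) -> measurable C ->
  (\int[Q]_(w in [set w | C (X w - Y w)%R]) (g (Y w))%:E =
   \int[mu]_y ((g y)%:E * \int[mu]_(x in [set x | C (x - y)%R]) (p x)%:E * (q y)%:E))%E.
Proof.
move=> mp p0 mq dX dY ind mg g0 mC.
pose XY w := (X w, Y w).
have mXY : measurable_fun setT XY by exact: measurable_fun_pair.
pose E := [set z : R * R | C (z.1 - z.2)].
have mE : measurable E.
  have md : measurable_fun setT (fun z : R * R => z.1 - z.2) by exact: measurable_funB.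
  by rewrite -[E]setTI; exact: (md measurableT C mC).
pose h (z : R * R) : \bar R := (g z.2 * \1_E z)%:E.
have mh : measurable_fun setT h.
  apply/measurable_EFinP; apply: measurable_funM; last exact: measurable_indic.
  exact: (measurableT_comp mg measurable_snd).
have h0 z : (0 <= h z)%E by rewrite lee_fin mulr_ge0.
transitivity (\int[Q]_w h (XY w))%E.
  rewrite integral_mkcond; apply: eq_integral => w _ /=.
  rewrite /patch /h indicE /E /XY /=.
  by have [Cw|Cw] := pselect (C (X w - Y w));
    [rewrite !mem_set // mulr1|rewrite !memNset // mulr0].
transitivity (\int[distribution Q X \x distribution Q Y]_z h z)%E.
  rewrite -[LHS](@ge0_integral_pushforward _ _ _ _ _ _ mXY Q setT h) //.
  apply/esym/eq_measure_integral => A mA _.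
  apply: product_measure_unique => //.
rewrite fubini_tonelli1 // fubini_tonelli //.
pose k y : \bar R := ((g y)%:E * \int[mu]_(x in [set x | C (x - y)%R]) (p x)%:E)%E.
have k0 y : (0 <= k y)%E.
  by rewrite mule_ge0 ?lee_fin // integral_ge0 // => x _; rewrite lee_fin.
have mk : measurable_fun setT k.
  apply: emeasurable_funM; first exact/measurable_EFinP.
  (* Written as a section integral of [p] times the indicator of [E], the inner integral is
     measurable in [y] by Tonelli's theorem. *)
  have : measurable_fun setT (fun y : R => \int[mu]_x ((p x * \1_E (x, y))%R%:E))%E.
    apply: (@measurable_fun_fubini_tonelli_G _ _ _ _ _ mu
      (fun z => (p z.1 * \1_E z)%:E)) => //.
      apply/measurable_EFinP; apply: measurable_funM; last exact: measurable_indic.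
      exact: (measurableT_comp mp measurable_fst).
    by move=> z; rewrite lee_fin mulr_ge0.
  congr (measurable_fun _ _); apply/funext => y; rewrite [RHS]integral_mkcond.
  apply: eq_integral => x _; rewrite /patch indicE /E /=.
  by have [Cw|Cw] := pselect (C (x - y));
    [rewrite !mem_set // mulr1|rewrite !memNset // mulr0].
transitivity (\int[distribution Q Y]_y k y)%E.
  apply: eq_integral => y _; rewrite /fubini_G.
  have mCy : measurable [set x | C (x - y)%R].
    rewrite -[X in measurable X]setTI; exact: (measurable_addr (- y)).
  rewrite /k -dX // -[Q _]/(distribution Q X [set x | C (x - y)%R]).
  transitivity (\int[distribution Q X]_x ((g y)%:E * (\1_[set x | C (x - y)%R] x)%:E))%E.
    apply: eq_integral => x _; rewrite /h EFinM !indicE.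
    by congr (_ * (nat_of_bool _)%:R%:E)%E.
  rewrite ge0_integralZl ?lee_fin //.
    by rewrite integral_indic // setIT.
  by apply/measurable_EFinP; exact: measurable_indic.
by rewrite ge0_integral_distribution //; exact: expectation_density.
Qed.

End pair_law.

(** * The maximum on the event that the range is at most [t] *)

Section slices.
Variables (R : realType) (d : measure_display) (T : measurableType d).
Local Notation mu := (@lebesgue_measure R).
Variable f : R -> R.
Hypothesis pf : prob_density f.

Let F := dist_fun f.

Lemma density_shift_itv_closed c a b : a <= b ->
  (\int[mu]_(x in [set x | (x - c)%R \in `[a, b]%R]) (f (x - c)%R)%:E = (F b - F a)%R%:E)%E.
Proof.
move=> ab; rewrite -(dist_fun_itv_closed pf ab).
apply: (@ge0_integral_shift _ (- c) `[a, b]%classic (EFin \o f)) => //.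
  by apply: measurable_funTS; apply/measurable_EFinP; exact: density_measurable.
by move=> x _; rewrite lee_fin density_ge0.
Qed.

Lemma density_shift_itv_open c a b : a <= b ->
  (\int[mu]_(x in [set x | (x - c)%R \in `[a, b[%R]) (f (x - c)%R)%:E = (F b - F a)%R%:E)%E.
Proof.
move=> ab; rewrite -(dist_fun_itv_open pf ab).
apply: (@ge0_integral_shift _ (- c) `[a, b[%classic (EFin \o f)) => //.
  by apply: measurable_funTS; apply/measurable_EFinP; exact: density_measurable.
by move=> x _; rewrite lee_fin density_ge0.
Qed.

Variables (Q : probability T R) (X1 X2 : {mfun T >-> R}) (th1 th2 : R).
Hypothesis d1 : has_density Q X1 (fun x => f (x - th1)).
Hypothesis d2 : has_density Q X2 (fun x => f (x - th2)).
Hypothesis ind : independent2 Q X1 X2.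

Definition range_le (t : R) : set T :=
  [set w | Num.max (X1 w) (X2 w) - Num.min (X1 w) (X2 w) <= t].

(** The event is split according to which observation is the maximum. Ties go to the first piece,
    whence the half-open interval in the second. *)
Lemma range_leE t : 0 <= t -> range_le t =
  [set w | (X1 w - X2 w)%R \in `[- t, 0]%R] `|` [set w | (X2 w - X1 w)%R \in `[- t, 0[%R].
Proof.
move=> t0; apply/seteqP; split => w; rewrite /range_le /= !in_itv /=.
  case: (leP (X1 w) (X2 w)) => x12 ut; [left|right]; apply/andP; split; lra.
by case=> /andP[]; case: (leP (X1 w) (X2 w)); lra.
Qed.

Lemma range_max_measurable :
  measurable_fun setT (fun w => Num.max (X1 w) (X2 w)).
Proof. exact: measurable_maxr. Qed.

Lemma range_measurable :
  measurable_fun setT (fun w => Num.max (X1 w) (X2 w) - Num.min (X1 w) (X2 w)).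
Proof. by apply: measurable_funB; [exact: measurable_maxr|exact: measurable_minr]. Qed.

Lemma range_le_measurable t : measurable (range_le t).
Proof.
have := range_measurable measurableT (measurable_itv `]-oo, t]%R).
congr measurable; apply/seteqP; split => w; rewrite /range_le /= in_itv /=.
  by case.
by [].
Qed.

(** Each piece of the event contributes one summand of [slice]: the density of the larger
    observation times the probability that the other one lies in the window below it, after centring
    at [th2]. *)
Lemma expectation_slice t (g : R -> R) : 0 <= t ->
  measurable_fun setT g -> (forall z, 0 <= g z) ->
  (\int[Q]_(w in range_le t) (g (Num.max (X1 w) (X2 w) - th2)%R)%:E =
   \int[mu]_z (g z * slice f (th2 - th1) t z)%R%:E)%E.
Proof.
move=> t0 mg g0; rewrite range_leE //.
have mX12 : measurable_fun setT (fun w => X1 w - X2 w) by exact: measurable_funB.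
have mX21 : measurable_fun setT (fun w => X2 w - X1 w) by exact: measurable_funB.
have mA : measurable [set w | (X1 w - X2 w)%R \in `[- t, 0]%R].
  by rewrite -[X in measurable X]setTI; exact: (mX12 measurableT `[- t, 0]%classic).
have mB : measurable [set w | (X2 w - X1 w)%R \in `[- t, 0[%R].
  by rewrite -[X in measurable X]setTI; exact: (mX21 measurableT `[- t, 0[%classic).
have mgs c : measurable_fun setT (fun y : R => g (y - c)).
  by apply: (measurableT_comp mg); exact: measurable_addr.
rewrite ge0_integral_setU //; last 3 first.
- apply/measurable_EFinP/measurable_funTS; apply: (measurableT_comp (mgs th2)).
  exact: range_max_measurable.
- by move=> w _; rewrite lee_fin.
- rewrite disj_set2E; apply/eqP/seteqP; split => // w /=.
  by rewrite !in_itv /= => -[/andP[? ?] /andP[? ?]]; lra.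
have mf1 := density_shift_measurable pf th1; have mf2 := density_shift_measurable pf th2.
have -> : (\int[Q]_(w in [set w | (X1 w - X2 w)%R \in `[- t, 0]%R])
     (g (Num.max (X1 w) (X2 w) - th2)%R)%:E =
   \int[mu]_z (g z * (f z * window f t (z + (th2 - th1))))%R%:E)%E.
  (* Here [X2 = z + th2] is the maximum; [X1 - th1] must fall in the window that ends at
     [z + (th2 - th1)]. *)
  transitivity (\int[Q]_(w in [set w | (X1 w - X2 w)%R \in `[- t, 0]%R]) (g (X2 w - th2)%R)%:E)%E.
    apply: eq_integral => w; rewrite inE /= in_itv /= => /andP[_ x12].
    by rewrite max_r // -subr_le0.
  have := @expectation_difference_event _ _ _ Q X1 X2 _ _ (fun y => g (y - th2))
    `[- t, 0]%classic mf1 (fun x => density_ge0 pf _) mf2 d1 d2 ind (mgs _) (fun y => g0 _).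
  move=> -> //.
  have := @ge0_integral_shift _ (- th2) setT (fun z => (g z * (f z * window f t (z + (th2 - th1))))%R%:E).
  rewrite preimage_setT => <- //; last 2 first.
  - apply/measurable_EFinP; apply: measurable_funM => //; apply: measurable_funM.
      exact: density_measurable.
    exact: window_measurable.
  - by move=> z _; rewrite lee_fin; apply: mulr_ge0 => //; apply: mulr_ge0;
    [exact: density_ge0|exact: window_ge0].
  apply: eq_integral => y _.
  have -> : [set x | `[- t, 0]%classic (x - y)] = [set x | (x - th1)%R \in `[y - th1 - t, y - th1]%R].
    by apply/seteqP; split => x /=; rewrite !in_itv /= => /andP[? ?]; apply/andP; split; lra.
  rewrite density_shift_itv_closed ?gerBl // -!EFinM; congr EFin.
  rewrite /window (_ : y - th2 + (th2 - th1) = y - th1); last by ring.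
  by rewrite -!mulrA [_ * f _]mulrC.
have -> : (\int[Q]_(w in [set w | (X2 w - X1 w)%R \in `[- t, 0[%R])
     (g (Num.max (X1 w) (X2 w) - th2)%R)%:E =
   \int[mu]_z (g z * (f (z + (th2 - th1)) * window f t z))%R%:E)%E.
  (* Here [X1 = z + th2] is the maximum, with density [f (z + (th2 - th1))]; [X2 - th2] must fall in
     the window that ends at [z]. *)
  transitivity (\int[Q]_(w in [set w | (X2 w - X1 w)%R \in `[- t, 0[%R]) (g (X1 w - th2)%R)%:E)%E.
    apply: eq_integral => w; rewrite inE /= in_itv /= => /andP[_ x12].
    by rewrite max_l // ltW // -subr_lt0.
  have ind' : independent2 Q X2 X1 by move=> A B mA' mB'; rewrite setIC muleC; exact: ind.
  have := @expectation_difference_event _ _ _ Q X2 X1 _ _ (fun y => g (y - th2))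
    `[- t, 0[%classic mf2 (fun x => density_ge0 pf _) mf1 d2 d1 ind' (mgs _) (fun y => g0 _).
  move=> -> //.
  have := @ge0_integral_shift _ (- th2) setT (fun z => (g z * (f (z + (th2 - th1)) * window f t z))%R%:E).
  rewrite preimage_setT => <- //; last 2 first.
  - apply/measurable_EFinP; apply: measurable_funM => //; apply: measurable_funM.
      exact: density_shift_measurableD.
    by have := window_measurable pf t 0; under eq_fun do rewrite addr0.
  - by move=> z _; rewrite lee_fin; apply: mulr_ge0 => //; apply: mulr_ge0;
    [exact: density_ge0|exact: window_ge0].
  apply: eq_integral => y _.
  have -> : [set x | `[- t, 0[%classic (x - y)] = [set x | (x - th2)%R \in `[y - th2 - t, y - th2[%R].
    by apply/seteqP; split => x /=; rewrite !in_itv /= => /andP[? ?]; apply/andP; split; lra.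
  rewrite density_shift_itv_open ?gerBl // -!EFinM; congr EFin.
  rewrite /window (_ : y - th2 + (th2 - th1) = y - th1); last by ring.
  by rewrite -!mulrA [_ * f _]mulrC.
have mw0 : measurable_fun setT (window f t).
  by have := window_measurable pf t 0; under eq_fun do rewrite addr0.
rewrite -ge0_integralD //.
- by apply: eq_integral => z _; rewrite -EFinD -mulrDr.
- by move=> z _; rewrite lee_fin; apply: mulr_ge0 => //; apply: mulr_ge0;
    [exact: density_ge0|exact: window_ge0].
- apply/measurable_EFinP; apply: measurable_funM => //; apply: measurable_funM.
    exact: density_measurable.
  exact: window_measurable.
- by move=> z _; rewrite lee_fin; apply: mulr_ge0 => //; apply: mulr_ge0;
    [exact: density_ge0|exact: window_ge0].
- apply/measurable_EFinP; apply: measurable_funM => //; apply: measurable_funM => //.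
  exact: density_shift_measurableD.
Qed.

End slices.

(** * The MLR property passed on to intervals, windows and slices *)

Section mlr.
Variable R : realType.
Local Notation mu := (@lebesgue_measure R).
Variable f : R -> R.
Hypotheses (pf : prob_density f) (mlr : MLR f).

Let F := dist_fun f.

(** The MLR inequality for the parameters [- l < 0]; the case [l = 0] is separate because they must
    be distinct. *)
Lemma mlr_shift l p q : 0 <= l -> p < q -> f p * f (q + l) <= f (p + l) * f q.
Proof.
rewrite le_eqVlt => /predU1P[<-|l0] pq; first by rewrite !addr0.
have := mlr pq (_ : - l < 0); rewrite !opprK !subr0; apply; lra.
Qed.

Lemma density_itv_shift l a b : a <= b ->
  (\int[mu]_(x in `]a, b]) (f (x + l)%R)%:E = (F (b + l) - F (a + l))%R%:E)%E.
Proof.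
move=> ab; rewrite -(dist_fun_itv pf) ?lerD2r //.
rewrite -(@ge0_integral_shift _ l `]a + l, b + l]%classic (EFin \o f)) //.
- by congr (integral _ _ _); apply/seteqP; split => x /=; rewrite !in_itv /= ltrD2r lerD2r.
- by apply: measurable_funTS; apply/measurable_EFinP; exact: density_measurable.
- by move=> x _; rewrite lee_fin density_ge0.
Qed.

Lemma le_integral_itv a b k1 k2 l1 l2 : a <= b -> 0 <= k1 -> 0 <= k2 ->
  (forall x, a < x -> x <= b -> k1 * f (x + l1) <= k2 * f (x + l2)) ->
  k1 * (F (b + l1) - F (a + l1)) <= k2 * (F (b + l2) - F (a + l2)).
Proof.
move=> ab k10 k20 H.
rewrite -lee_fin 2!EFinM -!density_itv_shift //.
have mfl l : measurable_fun `]a, b]%classic (fun x => (f (x + l)%R)%:E).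
  by apply/measurable_EFinP/measurable_funTS; exact: density_shift_measurableD.
have fl0 l x : (0 <= (f (x + l)%R)%:E)%E by rewrite lee_fin density_ge0.
rewrite -!ge0_integralZl ?lee_fin //; [|exact: mfl..].
apply: ge0_le_integral => //.
- by move=> x _; rewrite mule_ge0 // lee_fin.
- by apply: emeasurable_funM; [exact: measurable_cst|exact: mfl].
- by apply: emeasurable_funM; [exact: measurable_cst|exact: mfl].
- by move=> x /=; rewrite in_itv /= => /andP[ax xb]; rewrite -!EFinM lee_fin; exact: H.
Qed.

(** [mlr_shift] integrated over [x] in []a, b]] and [y] in []c, e]]; the condition [b <= c] ensures
    [x < y]. *)
Lemma mlr_itv l a b c e : 0 <= l -> a <= b -> b <= c -> c <= e ->
  (F b - F a) * (F (e + l) - F (c + l)) <= (F (b + l) - F (a + l)) * (F e - F c).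
Proof.
move=> l0 ab bc ce.
rewrite [leLHS]mulrC [leRHS]mulrC.
have := @le_integral_itv a b (F (e + l) - F (c + l)) (F e - F c) 0 l ab.
rewrite !addr0 !subr_ge0; apply.
- by apply: dist_fun_nondecreasing => //; rewrite lerD2r.
- exact: dist_fun_nondecreasing.
move=> x ax xb; rewrite addr0 [leLHS]mulrC [leRHS]mulrC.
have := @le_integral_itv c e (f x) (f (x + l)) l 0 ce.
rewrite !addr0; apply; [exact: density_ge0|exact: density_ge0|move=> y cy ye].
rewrite addr0; apply: mlr_shift => //; lra.
Qed.

(* Overlapping windows I O and O J, with I, O, J consecutive intervals: the
   product inequality is the sum of those for (I, J), (I, O) and (O, J). *)
Lemma window_mlr l t z z' : 0 <= l -> 0 <= t -> z < z' ->
  window f t z * window f t (z' + l) <= window f t (z + l) * window f t z'.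
Proof.
move=> l0 t0 zz'; rewrite /window -/F.
rewrite (_ : z + l - t = z - t + l); last by ring.
rewrite (_ : z' + l - t = z' - t + l); last by ring.
have [zt|tz] := leP z (z' - t).
  by apply: mlr_itv => //; lra.
have i1 : z - t <= z' - t by lra.
have i2 : z' - t <= z by lra.
have h1 := mlr_itv l0 i1 i2 (ltW zz').
have h2 := mlr_itv l0 i1 (lexx _) i2.
have h3 := mlr_itv l0 i2 (lexx _) (ltW zz').
move: h1 h2 h3.
move: (F z) (F (z - t)) (F z') (F (z' - t)) (F (z + l)) (F (z - t + l)) (F (z' + l)) (F (z' - t + l)).
by move=> a b a' b' c e c' e'; lra.
Qed.

(** Formally [slice / (f w)] is the sum of [w(z + l) / w(z)] and [f(z + l) / f(z)], nonincreasing by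
    [window_mlr] and [mlr_shift]. The products avoid dividing by [f] or [w], which may vanish. *)
Lemma slice_mlr l t z z' : 0 <= l -> 0 <= t -> z < z' ->
  window f t z * f z * slice f l t z' <= slice f l t z * (window f t z' * f z').
Proof.
move=> l0 t0 zz'; rewrite /slice.
have h1 := window_mlr l0 t0 zz'; have h2 := mlr_shift l0 zz'.
have h3 := ler_wpM2l (mulr_ge0 (density_ge0 pf z) (density_ge0 pf z')) h1.
have h4 := ler_wpM2l (mulr_ge0 (window_ge0 pf z t0) (window_ge0 pf z' t0)) h2.
move: h3 h4.
move: (f z) (f z') (f (z + l)) (f (z' + l)).
move: (window f t z) (window f t z') (window f t (z + l)) (window f t (z' + l)).
by move=> w w' wl wl' a a' al al'; lra.
Qed.

End mlr.

(** * Comparison of weighted integrals of a function that changes sign once *)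

Section single_crossing.
Variable R : realType.
Local Notation mu := (@lebesgue_measure R).
Variables D k s : R -> R.
Hypotheses (mD : measurable_fun setT D) (mk : measurable_fun setT k)
  (ms : measurable_fun setT s).
Hypotheses (k0 : forall z, 0 <= k z) (s0 : forall z, 0 <= s z).
Hypothesis ndD : forall x y, x <= y -> D y <= D x.

Let pos z := Num.max (D z) 0.
Let neg z := Num.max (- D z) 0.

Let pos0 z : 0 <= pos z. Proof. by rewrite le_max lexx orbT. Qed.
Let neg0 z : 0 <= neg z. Proof. by rewrite le_max lexx orbT. Qed.

Let mpos : measurable_fun setT pos. Proof. exact: measurable_maxr. Qed.
Let mneg : measurable_fun setT neg.
Proof. by apply: measurable_maxr => //; exact: measurable_funN. Qed.

(** The integral of [D * k] is the difference of those of its positive and negative parts, both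
    finite by integrability. *)
Lemma single_crossing_parts :
  mu.-integrable setT (fun z => (D z * k z)%:E) ->
  0 <= \int[mu]_z (D z * k z) ->
  (\int[mu]_z (neg z * k z)%:E <= \int[mu]_z (pos z * k z)%:E)%E /\
  (\int[mu]_z (pos z * k z)%:E < +oo)%E.
Proof.
move=> iD D0.
have ip : mu.-integrable setT (fun z => (pos z * k z)%:E).
  apply: (le_integrable measurableT _ _ iD) => /=.
    by apply/measurable_EFinP; exact: measurable_funM.
  move=> z _; rewrite lee_fin !normrM ler_wpM2r // (ger0_norm (pos0 z)).
  by rewrite ge_max ler_norm normr_ge0.
have im : mu.-integrable setT (fun z => (neg z * k z)%:E).
  apply: (le_integrable measurableT _ _ iD) => /=.
    by apply/measurable_EFinP; exact: measurable_funM.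
  move=> z _; rewrite lee_fin !normrM ler_wpM2r // (ger0_norm (neg0 z)).
  by rewrite ge_max -normrN ler_norm normr_ge0.
have fp : (\int[mu]_z (pos z * k z)%:E)%E \is a fin_num by exact: integrable_fin_num.
have fm : (\int[mu]_z (neg z * k z)%:E)%E \is a fin_num by exact: integrable_fin_num.
split; last by rewrite -ge0_fin_numE // integral_ge0 // => z _; rewrite lee_fin mulr_ge0.
rewrite -(fineK fp) -(fineK fm) lee_fin -subr_ge0 -[X in _ <= X - _]/(\int[mu]_z (pos z * k z)).
rewrite -[X in _ <= _ - X]/(\int[mu]_z (neg z * k z)) -RintegralB //.
apply: (le_trans D0); rewrite le_eqVlt; apply/orP; left; apply/eqP.
apply: eq_Rintegral => z _; rewrite -mulrBl /pos /neg; congr (_ * _).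
by case: (leP (D z) 0); case: (leP (- D z) 0); lra.
Qed.

Hypothesis cross : forall z z', z < z' -> k z * s z' <= s z * k z'.

(** Points with [D > 0] lie to the left of points with [D < 0], so [cross] applies to every such
    pair. Integrating over both points gives [Ak * Bs <= As * Bk], and [Bk <= Ak] bounds this by
    [As * Ak]. Cancelling [Ak] requires it to be positive and finite; [As] may be infinite. *)
Lemma single_crossing :
  (\int[mu]_z (neg z * k z)%:E <= \int[mu]_z (pos z * k z)%:E)%E ->
  (0 < \int[mu]_z (pos z * k z)%:E < +oo)%E ->
  (\int[mu]_z (neg z * s z)%:E <= \int[mu]_z (pos z * s z)%:E)%E.
Proof.
move=> BA /andP[A0 Aoo].
set Ak := (\int[mu]_z (pos z * k z)%:E)%E in BA A0 Aoo *.
set Bk := (\int[mu]_z (neg z * k z)%:E)%E in BA *.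
set As := (\int[mu]_z (pos z * s z)%:E)%E; set Bs := (\int[mu]_z (neg z * s z)%:E)%E.
have m_ (u v : R -> R) : measurable_fun setT u -> measurable_fun setT v ->
    measurable_fun setT (fun z : measurableTypeR R => (u z * v z)%:E).
  by move=> mu_ mv; apply/measurable_EFinP; exact: measurable_funM.
have n_ (u v : R -> R) : (forall z, 0 <= u z) -> (forall z, 0 <= v z) ->
    forall z, (0 <= (u z * v z)%:E)%E.
  by move=> u0 v0 z; rewrite lee_fin mulr_ge0.
have i0 (u v : R -> R) : (forall z, 0 <= u z) -> (forall z, 0 <= v z) ->
    (0 <= \int[mu]_z (u z * v z)%:E)%E.
  by move=> u0 v0; apply: integral_ge0 => z _; exact: n_.
have pt z z' : (pos z * k z) * (neg z' * s z') <= (pos z * s z) * (neg z' * k z').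
  have [Dz|Dz] := leP (D z) 0; first by rewrite /pos max_r // !mul0r.
  have [Dz'|Dz'] := leP 0 (D z').
    by rewrite /neg max_r ?oppr_le0 // !mul0r !mulr0.
  have zz' : z < z'.
    by rewrite ltNge; apply/negP => /ndD; rewrite leNgt (lt_trans Dz').
  rewrite [leLHS](_ : _ = pos z * neg z' * (k z * s z')); last by ring.
  rewrite [leRHS](_ : _ = pos z * neg z' * (s z * k z')); last by ring.
  by apply: ler_wpM2l; [exact: mulr_ge0|exact: cross].
have in1 z : ((pos z * k z)%:E * Bs <= (pos z * s z)%:E * Bk)%E.
  rewrite /Bs /Bk -!ge0_integralZl ?lee_fin ?mulr_ge0 //;
    [|exact: m_|by move=> *; exact: n_|exact: m_|by move=> *; exact: n_].
  apply: ge0_le_integral => //.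
  - by move=> z' _; rewrite mule_ge0 // n_.
  - by apply: emeasurable_funM; [exact: measurable_cst|exact: m_].
  - by apply: emeasurable_funM; [exact: measurable_cst|exact: m_].
  - by move=> z' _; rewrite -!EFinM lee_fin.
have in2 : (Ak * Bs <= As * Bk)%E.
  rewrite /Ak /As -!ge0_integralZr ?i0 //;
    [|exact: m_|by move=> *; exact: n_|exact: m_|by move=> *; exact: n_].
  apply: ge0_le_integral => //.
  - by move=> z' _; rewrite mule_ge0 ?n_ ?i0.
  - by apply: emeasurable_funM; [exact: m_|exact: measurable_cst].
  - by apply: emeasurable_funM; [exact: m_|exact: measurable_cst].
have fA : Ak \is a fin_num by rewrite ge0_fin_numE // ltW.
rewrite -(@lee_pmul2l _ Ak) //; apply: (le_trans in2).
by rewrite muleC; apply: lee_wpmul2r => //; exact: i0.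
Qed.

(** Supplies the positivity needed for the cancellation in [single_crossing]. If the positive part
    had integral zero, so would the negative part, hence [|D| * k = 0] almost everywhere. As [D]
    vanishes only on a null set, [k] would have no mass. *)
Lemma single_crossing_pos :
  mu.-negligible [set z | D z = 0] -> (0 < \int[mu]_z (k z)%:E)%E ->
  (\int[mu]_z (neg z * k z)%:E <= \int[mu]_z (pos z * k z)%:E)%E ->
  (0 < \int[mu]_z (pos z * k z)%:E)%E.
Proof.
move=> D0 kpos BA; rewrite lt_neqAle integral_ge0 ?andbT; last first.
  by move=> z _; rewrite lee_fin mulr_ge0.
apply/eqP => A0; move: BA; rewrite -A0 => B0.
have mpk : measurable_fun setT (fun z : measurableTypeR R => (pos z * k z)%:E).
  by apply/measurable_EFinP; exact: measurable_funM.
have mnk : measurable_fun setT (fun z : measurableTypeR R => (neg z * k z)%:E).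
  by apply/measurable_EFinP; exact: measurable_funM.
have C0 : (\int[mu]_z ((pos z * k z)%:E + (neg z * k z)%:E) = 0)%E.
  rewrite ge0_integralD //; last 2 first.
  - by move=> z _; rewrite lee_fin mulr_ge0.
  - by move=> z _; rewrite lee_fin mulr_ge0.
  rewrite -A0 add0e; apply/eqP; rewrite eq_le B0 /=.
  by apply: integral_ge0 => z _; rewrite lee_fin mulr_ge0.
have ae0 : ae_eq mu setT (fun z => (pos z * k z)%:E + (neg z * k z)%:E)%E (cst 0%E).
  apply/ae_eq_integral_abs => //; first exact: emeasurable_funD.
  rewrite -[RHS]C0; apply: eq_integral => z _.
  by rewrite gee0_abs // -EFinD lee_fin addr_ge0 // mulr_ge0.
have : ae_eq mu setT (EFin \o k) (cst 0%E).
  have [N1 [mN1 N10 N1s]] := ae0; have [N2 [mN2 N20 N2s]] := D0.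
  exists (N1 `|` N2); split; first exact: measurableU.
    by apply: null_set_setU.
  move=> z /= kz; have [/N2s|Dz] := pselect (D z = 0); first by right.
  left; apply: N1s => /= H; apply: kz => _; move: (H I); rewrite -EFinD => -[].
  have /lt_total/orP[Dz'|Dz'] : D z != 0 by apply/eqP.
  - rewrite /pos max_r 1?ltW // /neg max_l; last by rewrite oppr_ge0 ltW.
    by rewrite mul0r add0r => /eqP; rewrite mulf_eq0 oppr_eq0 lt_eqF //= => /eqP ->.
  - rewrite /neg max_r; last by rewrite oppr_le0 ltW.
    rewrite /pos max_l 1?ltW // mul0r addr0 => /eqP.
    by rewrite mulf_eq0 gt_eqF //= => /eqP ->.
move/ae_eq_integral => /(_ measurableT); rewrite integral0 => E.
by move: kpos; rewrite E ?ltxx //; exact/measurable_EFinP.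
Qed.

End single_crossing.

(** * Zeros of the increments of the loss *)

Section loss.
Variable R : realType.
Local Notation mu := (@lebesgue_measure R).
Variable W : R -> R.
Hypotheses (W0 : forall x, 0 <= W x) (C1 : condC1 W).

Lemma loss_gt0 x : x != 0 -> 0 < W x.
Proof.
have [_ dec inc] := C1 => /lt_total/orP[x0|x0].
  by apply: le_lt_trans (W0 (x / 2)) _; apply: dec; lra.
by apply: le_lt_trans (W0 (x / 2)) _; apply: inc; lra.
Qed.

(** Otherwise [x - c'] and [x - c] lie on the same side of the minimum of [W], possibly one of them
    at it, and [W] separates them. *)
Lemma loss_increment_zero_between c c' x : c < c' ->
  W (x - c') - W (x - c) = 0 -> c < x < c'.
Proof.
have [W00 dec inc] := C1 => cc' E; apply/andP; split; rewrite ltNge; apply/negP => xc.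
  (* At an end point one argument is [0], where strict monotonicity is silent and positivity of [W]
     elsewhere decides. *)
  have [v0|v0] := eqVneq (x - c) 0.
    have := @loss_gt0 (x - c'); rewrite v0 W00 in E.
    by rewrite lt_eqF => [/(_ isT)|]; lra.
  have := dec (x - c') (x - c) ltac:(lra).
  have : x - c < 0 by rewrite lt_neqAle v0; lra.
  by move=> v /(_ v); lra.
have [v0|v0] := eqVneq (x - c') 0.
  have := @loss_gt0 (x - c); rewrite v0 W00 in E.
  by rewrite gt_eqF => [/(_ isT)|]; lra.
have : 0 < x - c' by rewrite lt_neqAle eq_sym v0; lra.
by move=> /inc h; have := h (x - c) ltac:(lra); lra.
Qed.

(** There is at most one zero: between [c] and [c'], [W(z - c')] strictly decreases and [W(z - c)]
    strictly increases in [z]. *)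
Lemma loss_increment_zeros_negligible c c' : c < c' ->
  mu.-negligible [set z | W (z - c') - W (z - c) = 0].
Proof.
move=> cc'; have [_ dec inc] := C1.
have uniq x y : W (x - c') - W (x - c) = 0 -> W (y - c') - W (y - c) = 0 -> ~ x < y.
  move=> Ex Ey xy.
  have /andP[? ?] := loss_increment_zero_between cc' Ex.
  have /andP[? ?] := loss_increment_zero_between cc' Ey.
  have := dec (x - c') (y - c') ltac:(lra) ltac:(lra).
  have := inc (x - c) (y - c) ltac:(lra) ltac:(lra).
  lra.
have [[x Ex]|nx] := pselect (exists x, W (x - c') - W (x - c) = 0).
  apply: (@negligibleS _ _ _ mu [set x]) => [z /= Ez|].
    by apply/eqP; rewrite eq_le !leNgt; apply/andP; split; apply/negP; exact: uniq.
  by apply/negligibleP => //; exact: lebesgue_measure_set1.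
rewrite (_ : [set _ | _] = set0); first exact: negligible_set0.
by apply/seteqP; split => // z Ez; apply: nx; exists z.
Qed.

End loss.

(** * Positivity of the mass of the weight [f w] *)

Section window_mass.
Variables (R : realType) (d : measure_display) (T : measurableType d).
Local Notation mu := (@lebesgue_measure R).
Variables (f : R -> R) (Q : probability T R) (X1 X2 : {mfun T >-> R}).
Hypotheses (pf : prob_density f) (d1 : has_density Q X1 (fun x => f (x - 0)))
  (d2 : has_density Q X2 (fun x => f (x - 0))) (ind : independent2 Q X1 X2).

Let F := dist_fun f.

(* Otherwise P(U <= t) = 0 for equal parameters, hence P(X in J)^2 = 0 for every
   interval J of length t. *)
Lemma window_mass_gt0 t : 0 < t -> (0 < \int[mu]_z (window f t z * f z)%:E)%E.
Proof.
move=> t0; have wf0 z : 0 <= window f t z * f z.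
  by apply: mulr_ge0; [apply: (window_ge0 pf); exact: ltW|exact: density_ge0].
rewrite lt_neqAle integral_ge0 ?andbT; last by move=> z _; rewrite lee_fin.
apply/eqP => K0.
have mw0 : measurable_fun setT (window f t).
  by have := window_measurable pf t 0; under eq_fun do rewrite addr0.
have mwf : measurable_fun setT (fun z : measurableTypeR R => (window f t z * f z)%:E).
  by apply/measurable_EFinP; apply: measurable_funM => //; exact: density_measurable.
have QR : Q (range_le X1 X2 t) = 0%E.
  have := @expectation_slice _ _ _ f pf Q X1 X2 0 0 d1 d2 ind t (cst 1) (ltW t0)
    (measurable_cst _) (fun=> ler01).
  rewrite subrr /=; have mr := range_le_measurable X1 X2 t.
  rewrite integral_cst // mul1e => ->.
  (* At equal parameters the slice is twice [window f t z * f z]. *)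
  transitivity (\int[mu]_z ((window f t z * f z)%:E + (window f t z * f z)%:E))%E.
    apply: eq_integral => z _; rewrite /slice !addr0 mul1r -EFinD; congr EFin.
    by rewrite [f z * _]mulrC.
  by rewrite ge0_integralD // -?K0 ?adde0 // => z _; rewrite lee_fin.
have step a : F (a + t) = F a.
  have QE (X : {mfun T >-> R}) : has_density Q X (fun x => f (x - 0)) ->
      Q (X @^-1` `]a, a + t]) = (F (a + t) - F a)%:E.
    move=> dX; rewrite dX // -(dist_fun_itv pf) ?lerDl ?(ltW t0) //.
    by under eq_integral do rewrite subr0.
  have mp (X : {mfun T >-> R}) : measurable (X @^-1` `]a, a + t]).
    rewrite -[X in measurable X]setTI; exact: (measurable_funPT X).
  pose J : set R := `]a, a + t]%classic.
  have : (Q (X1 @^-1` J `&` X2 @^-1` J) <= 0)%E.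
    rewrite -QR; apply: le_measure; rewrite ?inE.
    - exact: measurableI.
    - exact: range_le_measurable.
    - move=> w; rewrite /J /range_le /= !in_itv /= => -[/andP[? ?] /andP[? ?]].
      by case: (leP (X1 w) (X2 w)); lra.
  rewrite ind; [|exact: measurable_itv..]; rewrite (QE _ d1) (QE _ d2) -EFinM lee_fin -expr2 => H.
  have /eqP : (F (a + t) - F a) ^+ 2 = 0 by apply/eqP; rewrite eq_le H sqr_ge0.
  by rewrite sqrf_eq0 subr_eq0 => /eqP.
have stepn a n : F (a + t *+ n) = F a.
  by elim: n a => [|n IH] a; [rewrite mulr0n addr0|rewrite mulrS addrA IH step].
(* Since [F] has period [t], these intervals carry no mass; yet they exhaust the line, where [f] has
   mass one. *)
pose I n : set R := `]- (t *+ n), t *+ n]%classic.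
have In0 n : (\int[mu]_(x in I n) (f x)%:E = 0)%E.
  have tn0 : 0 <= t *+ n by rewrite mulrn_wge0 // ltW.
  rewrite (dist_fun_itv pf) ?ge0_cp //; congr EFin.
  have := stepn (- (t *+ n)) (n + n)%N.
  by rewrite mulrnDr addrA addNr add0r /F => ->; exact: subrr.
have ndI : nondecreasing_seq I.
  move=> m n mn; rewrite subsetEset => x; rewrite /I /= !in_itv /= => /andP[xl xr].
  have tmn : t *+ m <= t *+ n by rewrite -(mulr_natr t m) -(mulr_natr t n) ler_wpM2l ?(ltW t0) ?ler_nat.
  by rewrite (le_trans xr) // (le_lt_trans _ xl) // lerN2.
have UI : \bigcup_n I n = setT.
  apply/seteqP; split => // x _.
  have [n xn] : exists n, `|x| < t *+ n.
    exists (Num.bound (`|x| / t)).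
    have := archi_boundP (divr_ge0 (normr_ge0 x) (ltW t0)).
    by rewrite ltr_pdivrMr // mulrC mulr_natr.
  exists n => //; move: xn; rewrite /I /= in_itv /= ltr_norml => /andP[-> xt].
  exact: ltW.
have mfI n : measurable_fun (I n) (EFin \o f).
  by apply/measurable_EFinP/measurable_funTS; exact: density_measurable.
have f0 n x : I n x -> (0 <= (EFin \o f) x)%E by move=> _; rewrite lee_fin density_ge0.
have /(cvg_lim (@ereal_hausdorff R)) := @ge0_nondecreasing_set_cvg_integral _
  (measurableTypeR R) R I (EFin \o f) mu ndI (fun i => measurable_itv _) mfI f0.
rewrite UI (_ : (fun _ => _) = cst 0%E); last by apply/funext => n; exact: In0.
have [_ _ f1] := pf; rewrite lim_cst //= f1 => /eqP.
by rewrite eqe eq_sym oner_eq0.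
Qed.

End window_mass.

(** * Comparison of two constant shifts on a slice *)

Section key.
Variable R : realType.
Local Notation mu := (@lebesgue_measure R).
Variables (f W : R -> R).
Hypotheses (pf : prob_density f) (mlr : MLR f) (W0 : forall x, 0 <= W x).
Hypotheses (ac : abs_continuous W) (C1 : condC1 W) (C2 : condC2 W).

Let F := dist_fun f.

Lemma loss_shift_measurable c : measurable_fun setT (fun z : R => W (z - c)).
Proof.
apply: measurableT_comp; last exact: measurable_addr.
by apply: continuous_measurable_fun; exact: abs_continuous_continuous.
Qed.

Lemma loss_increment_integrable (k : R -> R) c c' : diff_under_integral W k ->
  mu.-integrable setT (fun z => ((W (z - c') - W (z - c)) * k z)%:E).
Proof.
move=> du; have [iW' _ _] := du c'; have [iW _ _] := du c.
rewrite (_ : (fun _ => _) = (fun z => (W (z - c') * k z)%R%:E - (W (z - c) * k z)%R%:E)%E).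
  exact: integrableB.
by apply/funext => z; rewrite -EFinB mulrBl.
Qed.

(** The supporting line at [z - c] bounds the increment below by [- (c' - c) * W'(z - c)], hence by
    [- (c' - c) * W'(z - c0)], since [W'] is nondecreasing and [z - c <= z - c0]. *)
Lemma loss_increment_integral_ge0 (k : R -> R) c0 c c' : c0 <= c -> c <= c' ->
  (forall z, 0 <= k z) -> diff_under_integral W k ->
  \int[mu]_z (derive1 W (z - c0) * k z) <= 0 ->
  0 <= \int[mu]_z ((W (z - c') - W (z - c)) * k z).
Proof.
move=> c0c cc' k0 du I0; have [N N0 [dW mW]] := C2.
have [_ id _] := du c0.
have iD := loss_increment_integrable c c' du.
pose a := c' - c; have a0 : 0 <= a by rewrite subr_ge0.
have ia : mu.-integrable setT (fun z => (a * (derive1 W (z - c0) * k z))%:E).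
  exact: (integrableZl measurableT a id).
pose G z := (W (z - c') - W (z - c)) * k z + a * (derive1 W (z - c0) * k z).
have G0 : 0 <= \int[mu]_z G z.
  have iG : mu.-integrable setT (fun z => (G z)%:E).
    exact: (integrableD measurableT iD ia).
  rewrite /Rintegral fine_ge0 //.
  (* [G] is known to be nonnegative only off a null set, so its integral is identified with that of
     its absolute value. *)
  have -> : (\int[mu]_z (G z)%:E = \int[mu]_z `|(G z)%:E|)%E; last first.
    by apply: integral_ge0 => z _; exact: abse_ge0.
  have mG := measurable_int _ iG.
  apply: ae_eq_integral => //; first exact: measurableT_comp.
  apply: (@negligibleS _ _ _ mu ((fun z => z - c) @^-1` N `|` (fun z => z - c0) @^-1` N)).
    move=> z /=; apply: contra_notP => /not_orP[/= Nc Nc0] _.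
    rewrite ger0_norm // /G mulrA -mulrDl mulr_ge0 //.
    have := tangent_below ac N0 dW mW (z - c') Nc.
    have := ler_wpM2l a0 (mW _ _ Nc Nc0 _).
    rewrite lerD2l lerN2 => /(_ c0c); rewrite /a; lra.
  by apply: negligibleU; exact: negligible_shift.
have H (x y : R) : 0 <= x + y -> y <= 0 -> 0 <= x by lra.
apply: H (mulr_ge0_le0 a0 I0).
by rewrite -RintegralZl // -RintegralD.
Qed.

(** The single-crossing comparison for the weights [f w] and [slice f lam t]; the sign condition at
    [c0] starts it through [loss_increment_integral_ge0]. *)
Lemma slice_loss_le (lam t c0 c c' : R) : 0 <= lam -> 0 <= t -> c0 <= c -> c <= c' ->
  (0 < t -> (0 < \int[mu]_z (window f t z * f z)%:E)%E) ->
  diff_under_integral W (fun z => (F z - F (z - t)) * f z) ->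
  \int[mu]_z (derive1 W (z - c0) * (F z - F (z - t)) * f z) <= 0 ->
  (\int[mu]_z (W (z - c) * slice f lam t z)%:E < +oo)%E ->
  (\int[mu]_z (W (z - c) * slice f lam t z)%:E <=
   \int[mu]_z (W (z - c') * slice f lam t z)%:E)%E.
Proof.
move=> lam0; rewrite le_eqVlt => /predU1P[<-|t0] c0c.
  (* For [t = 0] the windows are empty and the slice vanishes. *)
  move=> _ _ _ _ _; rewrite le_eqVlt; apply/orP; left; apply/eqP.
  by apply: eq_integral => z _; rewrite /slice /window !subr0 !subrr !mulr0 addr0 !mulr0.
rewrite le_eqVlt => /predU1P[->//|cc'] kpos du I0 fin.
have t0' := ltW t0.
pose k z := window f t z * f z; pose s := slice f lam t.
pose D z := W (z - c') - W (z - c).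
have mW := loss_shift_measurable.
have mw : measurable_fun setT (window f t).
  by have := window_measurable pf t 0; under eq_fun do rewrite addr0.
have mk : measurable_fun setT k.
  by apply: measurable_funM => //; exact: density_measurable.
have ms : measurable_fun setT s by exact: slice_measurable.
have mD : measurable_fun setT D by exact: measurable_funB.
have k0 z : 0 <= k z by apply: mulr_ge0; [exact: window_ge0|exact: density_ge0].
have s0 z : 0 <= s z by exact: slice_ge0.
have ndD x y : x <= y -> D y <= D x.
  by move=> xy; apply: increments_nonincreasing => //; exact: ltW.
have D0 : 0 <= \int[mu]_z (D z * k z).
  apply: (@loss_increment_integral_ge0 k c0) => //; first exact: ltW.
  by under eq_Rintegral do rewrite mulrA.
have iD := loss_increment_integrable c c' du.
have [BA Aoo] := single_crossing_parts mD mk k0 iD D0.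
have Apos := single_crossing_pos mD mk k0
  (loss_increment_zeros_negligible W0 C1 cc') (kpos t0) BA.
have cross z z' : z < z' -> k z * s z' <= s z * k z' by exact: slice_mlr.
have ABs := single_crossing mD mk ms k0 s0 ndD cross BA _.
have {}ABs : (\int[mu]_z (Num.max (- D z) 0 * s z)%:E <= \int[mu]_z (Num.max (D z) 0 * s z)%:E)%E.
  by apply: ABs; rewrite Apos.
have mM (u : R -> R) : measurable_fun setT u ->
    measurable_fun setT (fun z : measurableTypeR R => (u z * s z)%:E).
  by move=> mu_; apply/measurable_EFinP; exact: measurable_funM.
have mp : measurable_fun setT (fun z => Num.max (D z) 0) by exact: measurable_maxr.
have mn : measurable_fun setT (fun z => Num.max (- D z) 0).
  by apply: measurable_maxr => //; exact: measurable_funN.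
have p0 z : 0 <= Num.max (D z) 0 by rewrite le_max lexx orbT.
have n0 z : 0 <= Num.max (- D z) 0 by rewrite le_max lexx orbT.
(* An identity between sums, because the integral for [c'] may be infinite and cannot be
   subtracted. *)
have E : (\int[mu]_z (W (z - c') * s z)%:E + \int[mu]_z (Num.max (- D z) 0 * s z)%:E =
    \int[mu]_z (W (z - c) * s z)%:E + \int[mu]_z (Num.max (D z) 0 * s z)%:E)%E.
  rewrite -!ge0_integralD //; try (by move=> z _; rewrite lee_fin mulr_ge0);
    try (exact: mM).
  apply: eq_integral => z _; rewrite -!EFinD -!mulrDl /D.
  congr ((_ * _)%:E); case: (leP (W (z - c') - W (z - c)) 0);
  case: (leP (- (W (z - c') - W (z - c))) 0); lra.
(* The negative part of the increment is at most [W(z - c)], whose integral is finite. *)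
have Bfin : (\int[mu]_z (Num.max (- D z) 0 * s z)%:E)%E \is a fin_num.
  rewrite ge0_fin_numE; last by apply: integral_ge0 => z _; rewrite lee_fin mulr_ge0.
  apply: le_lt_trans fin; apply: ge0_le_integral => //.
  - by move=> z _; rewrite lee_fin mulr_ge0.
  - exact: mM.
  - exact: mM.
  - move=> z _; rewrite lee_fin ler_wpM2r // ge_max W0 andbT /D opprB gerBl; exact: W0.
by rewrite -(leeD2rE _ _ Bfin) E leeD2l.
Qed.

End key.

(** * Rounding a function up to a finite grid *)

Section discretisation.
Variable R : realType.

(** Used to exhaust a sublevel event of [phi] by countably many events on the range. An attained
    supremum gives a constant sequence; otherwise the supremum is approached strictly from below, so
    every term stays below a point of [I]. *)
Lemma cofinal_sequence (I : set R) : has_sup I ->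
  exists s : nat -> R, [/\ {homo s : m n / (m <= n)%N >-> m <= n},
    (forall n, exists2 x, I x & s n <= x) & (forall x, I x -> exists n, x <= s n)].
Proof.
move=> hI; have ubI x : I x -> x <= sup I by apply: ub_le_sup; case: hI.
have [It|It] := pselect (I (sup I)).
  exists (fun=> sup I); split => //; first by move=> _; exists (sup I).
  by move=> x /ubI; exists 0%N.
exists (fun n => sup I - n.+1%:R^-1); split.
- by move=> m n mn; rewrite lerB // lef_pV2 ?posrE // ler_nat ltnS.
- move=> n; have [|x Ix /ltW xs] := @sup_adherent _ I n.+1%:R^-1 _ hI.
    by rewrite invr_gt0.
  by exists x.
- move=> x Ix; have : x < sup I.
    by rewrite lt_neqAle ubI // andbT; apply/eqP => xt; apply: It; rewrite -xt.
  by move=> /ltr_add_invr[n xn]; exists n; rewrite lerBrDr ltW.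
Qed.

Variables (phi : R -> R) (b h : R).
Hypotheses (h0 : 0 < h) (phib : forall u, phi u <= b).

(** The least of the values [b - j * h], [j <= k], that is at least [phi u]. Each recursion step
    adds a value at the lower end, so consecutive roundings differ only on a sublevel set of
    [phi]. *)
Fixpoint round_up (k : nat) (u : R) : R :=
  if k is k'.+1 then
    if phi u <= b - k%:R * h then b - k%:R * h else round_up k' u
  else b.

Lemma round_upE k u : phi u <= b - k%:R * h -> round_up k u = b - k%:R * h.
Proof. by case: k => [|k] /=; [rewrite mul0r subr0|move=> ->]. Qed.

Lemma round_up_bounds k u : b - k%:R * h <= phi u ->
  phi u <= round_up k u <= phi u + h.
Proof.
elim: k => [|k IH]; first by rewrite mul0r subr0 /= phib => /le_trans; apply; rewrite lerDl ltW.
rewrite /= => u2; case: ifPn => [u1|]; first by rewrite u1 (le_trans u2) ?lerDl ?(ltW h0).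
rewrite -ltNge => u1.
have [u3|u3] := leP (phi u) (b - k%:R * h); last by apply: IH; exact: ltW.
rewrite round_upE // u3 /=; move: u1; rewrite -natr1 mulrDl mul1r; set y := _ * h; lra.
Qed.

Hypothesis mphi : measurable_fun setT phi.

Lemma round_up_measurable k : measurable_fun setT (round_up k).
Proof.
elim: k => [|k IH] //=.
by apply: measurable_fun_ifT => //; exact: measurable_fun_ler.
Qed.

End discretisation.

(** * Risk comparison for ordered parameters *)

Section risk_comparison.
Variables (R : realType) (d : measure_display) (T : measurableType d).
Local Notation mu := (@lebesgue_measure R).
Variables (f W : R -> R) (Q : probability T R) (X1 X2 : {mfun T >-> R}) (th1 th2 : R).
Hypotheses (pf : prob_density f) (mlr : MLR f) (W0 : forall x, 0 <= W x).
Hypotheses (ac : abs_continuous W) (C1 : condC1 W) (C2 : condC2 W).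
Hypotheses (d1 : has_density Q X1 (fun x => f (x - th1)))
  (d2 : has_density Q X2 (fun x => f (x - th2))) (ind : independent2 Q X1 X2).
Hypothesis th12 : th1 <= th2.

Let F := dist_fun f.
Let U w := Num.max (X1 w) (X2 w) - Num.min (X1 w) (X2 w).
Let Z w := Num.max (X1 w) (X2 w) - th2.

Hypothesis kpos : forall t, 0 < t -> (0 < \int[mu]_z (window f t z * f z)%:E)%E.
Hypothesis duf : forall t, 0 <= t ->
  diff_under_integral W (fun z => (F z - F (z - t)) * f z).
Hypothesis fin : forall c, (\int[Q]_w (W (Z w - c))%:E < +oo)%E.

Variables (phi : R -> R) (b0 : R).
Hypotheses (nd : forall s t, s <= t -> phi s <= phi t)
  (lim : phi t @[t --> +oo] --> b0).
Hypothesis iii : forall t, 0 <= t ->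
  \int[mu]_z (derive1 W (z - phi t) * (F z - F (z - t)) * f z) <= 0.

Let U0 w : 0 <= U w. Proof. by rewrite subr_ge0 ge_min le_max lexx. Qed.

Let mU : measurable_fun setT U. Proof. exact: range_measurable. Qed.

Let mphi : measurable_fun setT phi.
Proof. by apply: nondecreasing_measurable => // x y; exact: nd. Qed.

Let mWZ (psi : R -> R) : measurable_fun setT psi ->
  measurable_fun setT (fun w => (W (Z w - psi (U w)))%:E).
Proof.
move=> mpsi; apply/measurable_EFinP; apply: measurableT_comp.
  by apply: continuous_measurable_fun; exact: abs_continuous_continuous.
apply: measurable_funB; last exact: measurableT_comp.
by apply: measurable_funB => //; exact: range_max_measurable.
Qed.

Let phib u : phi u <= b0.
Proof.
rewrite leNgt; apply/negP => bu.
have [M [_ HM]] : \forall t \near +oo, phi t < phi u by exact: (cvgr_lt b0 lim).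
have := HM (Num.max (M + 1) u); rewrite lt_max ltrDl ltr01 => /(_ isT).
by rewrite ltNge nd // le_max lexx orbT.
Qed.

Lemma loss_le_range s c c' : 0 <= s -> phi s <= c -> c <= c' ->
  (\int[Q]_(w in range_le X1 X2 s) (W (Z w - c))%:E <=
   \int[Q]_(w in range_le X1 X2 s) (W (Z w - c'))%:E)%E.
Proof.
move=> s0 sc cc'; have mW := loss_shift_measurable ac.
rewrite !(expectation_slice pf d1 d2 ind s0 (mW _)) //.
apply: (@slice_loss_le _ f W pf mlr W0 ac C1 C2 _ _ (phi s)) => //; rewrite ?subr_ge0 //.
- exact: kpos.
- exact: duf.
- exact: iii.
rewrite -(expectation_slice pf d1 d2 ind s0 (mW _)) //.
apply: le_lt_trans (fin c); apply: ge0_subset_integral => //.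
- exact: range_le_measurable.
- exact: (mWZ (measurable_cst c)).
- by move=> w _; rewrite lee_fin.
Qed.

(** Monotone convergence from [loss_le_range]. Since [phi] tends to [b0 > c], the arguments with
    [phi s <= c] are bounded above, and the event is an increasing union of events [U <= s]. *)
Lemma loss_le_sublevel c c' : c < b0 -> c <= c' ->
  (\int[Q]_(w in [set w | (phi (U w) <= c)%R]) (W (Z w - c))%:E <=
   \int[Q]_(w in [set w | (phi (U w) <= c)%R]) (W (Z w - c'))%:E)%E.
Proof.
move=> cb cc'; pose I := [set s | 0 <= s /\ phi s <= c].
have [phi0|phi0] := leP (phi 0) c; last first.
  rewrite (_ : [set _ | _] = set0) ?integral_set0 //; apply/seteqP; split => // w /=.
  by rewrite leNgt (lt_le_trans phi0) // nd.
have I0 : I 0 by split.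
have hI : has_sup I.
  split; first by exists 0.
  have [M [_ HM]] : \forall t \near +oo, c < phi t by exact: (cvgr_gt b0 lim).
  exists (M + 1) => x [_ xc]; rewrite leNgt; apply/negP => Mx.
  have : c < phi x by apply: HM; lra.
  by rewrite ltNge xc.
have [s [s_nd sI Is]] := cofinal_sequence hI.
(* The sequence may start below [0]; truncation is harmless because [phi 0 <= c]. *)
pose s' n := Num.max (s n) 0.
have s'0 n : 0 <= s' n by rewrite le_max lexx orbT.
have s'c n : phi (s' n) <= c.
  have [x [x0 xc] sx] := sI n; rewrite /s'.
  by have [//|_] := leP (s n) 0; exact: le_trans (nd sx) xc.
have ndE : nondecreasing_seq (fun n => range_le X1 X2 (s' n)).
  move=> m n mn; rewrite subsetEset => w; rewrite /range_le /= => /le_trans; apply.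
  by rewrite ge_max !le_max lexx orbT s_nd.
have UE : \bigcup_n range_le X1 X2 (s' n) = [set w | phi (U w) <= c].
  apply/seteqP; split => w /=.
    by move=> [n _ Uw]; apply: le_trans (s'c n); exact: nd.
  move=> wc; have [n Un] := Is (U w) (conj (U0 w) wc).
  by exists n => //; rewrite /range_le /= le_max Un.
have cv c1 : (\int[Q]_(w in range_le X1 X2 (s' n)) (W (Z w - c1))%:E @[n --> \oo] -->
    \int[Q]_(w in [set w | (phi (U w) <= c)%R]) (W (Z w - c1))%:E)%E.
  rewrite -UE; apply: ge0_nondecreasing_set_cvg_integral => //.
  - by move=> n; exact: range_le_measurable.
  - by move=> n; apply: measurable_funTS; exact: (mWZ (measurable_cst c1)).
  - by move=> n w _; rewrite lee_fin.
rewrite -(cvg_lim (@ereal_hausdorff R) (cv c)) -(cvg_lim (@ereal_hausdorff R) (cv c')).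
apply: lee_lim; [by apply/cvg_ex; eexists; exact: cv|by apply/cvg_ex; eexists; exact: cv|].
by apply: nearW => n; exact: loss_le_range.
Qed.

(** Induction on the grid: passing from [k] to [k.+1] lowers the shift from [c'] to [c] on [E] and
    changes nothing elsewhere. *)
Lemma risk_round_up_le h k : 0 < h ->
  (\int[Q]_w (W (Z w - round_up phi b0 h k (U w)))%:E <=
   \int[Q]_w (W (Z w - b0))%:E)%E.
Proof.
move=> h0; elim: k => [|k IH] //; apply: le_trans IH.
pose c := b0 - k.+1%:R * h; pose c' := b0 - k%:R * h.
have cc' : c <= c' by rewrite /c /c' -natr1 mulrDl mul1r; set y := _ * h; lra.
pose E := [set w | phi (U w) <= c].
have mE : measurable E.
  have := measurableT_comp mphi mU; move=> /(_ measurableT _ (measurable_itv `]-oo, c]%R)).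
  congr measurable; apply/seteqP; split => w; rewrite /E /= in_itv /= ?setTI //.
  by case.
have split_ (psi : R -> R) : measurable_fun setT psi ->
    (\int[Q]_w (W (Z w - psi (U w)))%:E =
     \int[Q]_(w in E) (W (Z w - psi (U w)))%:E +
     \int[Q]_(w in ~` E) (W (Z w - psi (U w)))%:E)%E.
  move=> mpsi; rewrite -ge0_integral_setU ?setUv //.
  - exact: measurableC.
  - exact: mWZ.
  - by move=> w _; rewrite lee_fin.
  - by rewrite disj_set2E setICr.
have mr j := @round_up_measurable R phi b0 h mphi j.
rewrite (split_ _ (mr k.+1)) (split_ _ (mr k)); apply: leeD.
  rewrite [leLHS](_ : _ = \int[Q]_(w in E) (W (Z w - c))%:E)%E; last first.
    by apply: eq_integral => w; rewrite inE /E /= => ->.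
  rewrite [leRHS](_ : _ = \int[Q]_(w in E) (W (Z w - c'))%:E)%E; last first.
    apply: eq_integral => w; rewrite inE /E /= => wc.
    by rewrite round_upE // (le_trans wc).
  apply: loss_le_sublevel => //; rewrite /c gtrBl mulr_gt0 //.
rewrite le_eqVlt; apply/orP; left; apply/eqP.
by apply: eq_integral => w; rewrite inE /E /= => /negP/negbTE ->.
Qed.

Lemma risk_le : (\int[Q]_w (W (Z w - phi (U w)))%:E <= \int[Q]_w (W (Z w - b0))%:E)%E.
Proof.
pose h n : R := n.+1%:R^-1.
have h0 n : 0 < h n by rewrite invr_gt0.
(* The grid of mesh [h n] must reach down to [phi 0], the least value of [phi] on the range of
   [U]. *)
have [K HK] : exists K : nat -> nat, forall n, b0 - (K n)%:R * h n <= phi 0.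
  exists (fun n => Num.bound ((b0 - phi 0) / h n)) => n.
  have b0phi : 0 <= (b0 - phi 0) / h n by rewrite divr_ge0 ?subr_ge0 // ltW.
  by have := archi_boundP b0phi; rewrite ltr_pdivrMr //; lra.
pose g n w := (W (Z w - round_up phi b0 (h n) (K n) (U w)))%:E.
have cg w : g n w @[n --> \oo] --> (W (Z w - phi (U w)))%:E.
  apply: cvg_EFin; first by apply: nearW.
  apply: (@cvg_comp _ _ _ (fun n => Z w - round_up phi b0 (h n) (K n) (U w)) W _
    (nbhs (Z w - phi (U w)))); last exact: abs_continuous_continuous.
  apply: cvgB; first exact: cvg_cst.
  apply: (@squeeze_cvgr _ _ _ _ (fun=> phi (U w)) (fun n => phi (U w) + h n)).
  - by apply: nearW => n; apply: round_up_bounds => //; exact: le_trans (HK n) (nd _).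
  - exact: cvg_cst.
  - rewrite -[X in _ --> X]addr0; apply: cvgD; first exact: cvg_cst.
    exact: cvg_harmonic.
have gl n : (\int[Q]_w g n w <= \int[Q]_w (W (Z w - b0))%:E)%E by exact: risk_round_up_le.
rewrite (_ : (\int[Q]_w (W (Z w - phi (U w)))%:E = \int[Q]_w limn_einf (g ^~ w))%E); last first.
  by apply: eq_integral => w _; rewrite (cvg_limn_einf_sup (cg w)).
apply: (le_trans (fatou _ _ _ _)) => //.
- by move=> n; apply: mWZ; exact: round_up_measurable.
- by move=> n w _; rewrite lee_fin.
rewrite limn_einf_lim; apply: lime_le; first exact: is_cvg_einfs.
(* The infimum over a tail is at most its first term, which [gl] bounds. *)
by apply: nearW => n; apply: ge_ereal_inf; exists (\int[Q]_w g n w)%E => //; exists n => /=.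
Qed.

End risk_comparison.

(** * Extension of [phi] to the line and reduction to ordered parameters *)

Theorem theorem2p5 (R : realType) (d : measure_display) (T : measurableType d)
    (f : R -> R) (P : R * R -> probability T R) (X1 X2 : {mfun T >-> R})
    (W phi : R -> R) (b0 : R) :
  let mu := @lebesgue_measure R in
  let F := dist_fun f in
  prob_density f ->
  location_model f P X1 X2 ->
  (forall x, 0 <= W x) ->
  MLR f ->
  abs_continuous W ->
  condC1 W -> condC2 W -> condC3 f P X1 X2 W ->
  unique (fun b : R => \int[mu]_x (derive1 W (x - b) * f x * F x) = 0) b0 ->
  (forall s t, 0 <= s -> s <= t -> phi s <= phi t) ->
  phi t @[t --> +oo] --> b0 ->
  (forall t, 0 <= t ->
     \int[mu]_z (derive1 W (z - phi t) * (F z - F (z - t)) * f z) <= 0) ->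
  forall theta : R * R,
    (risk P X1 X2 W theta (equivariant_est phi)
       <= risk P X1 X2 W theta (equivariant_est (cst b0)))%E.
Proof.
move=> mu F pf mod W0 mlr ac C1 C2 [fin _ duf] _ nd lim iii theta.
(* Monotonicity of [phi] is given on [[0, +oo[] only. The constant extension to the left is monotone
   everywhere and yields the same estimator, as [U >= 0]. *)
pose phi' u := phi (Num.max u 0).
have phi'E t : 0 <= t -> phi' t = phi t by move=> t0; rewrite /phi' max_l.
have nd' s t : s <= t -> phi' s <= phi' t.
  by move=> st; apply: nd; rewrite ?ge_max ?le_max ?lexx ?st ?orbT.
have lim' : phi' t @[t --> +oo] --> b0.
  apply: cvg_trans lim; apply: near_eq_cvg; near=> t.
  by rewrite phi'E //; near: t; exact: nbhs_pinfty_ge.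
have iii' t : 0 <= t ->
    \int[mu]_z (derive1 W (z - phi' t) * (F z - F (z - t)) * f z) <= 0.
  by move=> t0; rewrite phi'E //; exact: iii.
(* A property of [f] alone, obtained from the model at equal parameters. *)
have kpos t : 0 < t -> (0 < \int[mu]_z (window f t z * f z)%:E)%E.
  by have [e1 e2 ind] := mod (0, 0); exact: (window_mass_gt0 pf e1 e2 ind).
have U0 w : 0 <= Num.max (X1 w) (X2 w) - Num.min (X1 w) (X2 w).
  by rewrite subr_ge0 ge_min le_max lexx.
have [e1 e2 ind] := mod theta; have fin' := fin theta.
have [th12|/ltW th21] := leP theta.1 theta.2.
  have riskE psi : risk P X1 X2 W theta (equivariant_est psi) = (\int[P theta]_w
      (W (Num.max (X1 w) (X2 w) - theta.2 -
          psi (Num.max (X1 w) (X2 w) - Num.min (X1 w) (X2 w)))%R)%:E)%E.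
    rewrite /risk unlock; apply: eq_integral => w _.
    by rewrite /equivariant_est (max_r th12) addrAC.
  have := @risk_le _ _ _ f W (P theta) X1 X2 _ _ pf mlr W0 ac C1 C2 e1 e2 ind th12
    kpos duf _ phi' b0 nd' lim' iii'.
  rewrite !riskE => H; under eq_integral do rewrite -phi'E //.
  by apply: H => c; rewrite -(riskE (cst c)).
(* When [theta.2 < theta.1] the two observations exchange roles; the maximum and the minimum are
   symmetric. *)
have riskE psi : risk P X1 X2 W theta (equivariant_est psi) = (\int[P theta]_w
    (W (Num.max (X2 w) (X1 w) - theta.1 -
        psi (Num.max (X2 w) (X1 w) - Num.min (X2 w) (X1 w)))%R)%:E)%E.
  rewrite /risk unlock; apply: eq_integral => w _.
  by rewrite /equivariant_est (max_l th21) addrAC maxC minC.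
have ind' : independent2 (P theta) X2 X1.
  by move=> A B mA mB; rewrite setIC muleC; exact: ind.
have := @risk_le _ _ _ f W (P theta) X2 X1 _ _ pf mlr W0 ac C1 C2 e2 e1 ind' th21
  kpos duf _ phi' b0 nd' lim' iii'.
rewrite !riskE => H; under eq_integral do rewrite -phi'E ?(maxC (X2 _)) ?(minC (X2 _)) //.
under [X in (X <= _)%E]eq_integral do rewrite (maxC (X1 _)) (minC (X1 _)).
by apply: H => c; rewrite -(riskE (cst c)).
Unshelve. all: by end_near. Qed.
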